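(* Let $\mathcal{A}$ be a C*-algebra and let $\mathcal{B}$ be a C*-subalgebra of $\mathcal{A}$ such that $\mathcal{B}$ is central in $\mathcal{A}$. Then $\mathcal{B}$ has the same-norm approximation property in $\mathcal{A}$. More specifically, let $A \in \mathcal{A}$, let $F \in \mathcal{B}$, and let $G$ be the radial retraction of $F$ to the ball about $0$ of radius $\|A\|$ in $\mathcal{B}$ defined by the continuous-function calculus for normal elements. Then $\|A-G\| \leq \|A-F\|$ (and $\|G\| \leq \|A\|$).
   Context: $\mathcal{B}$ is central in $\mathcal{A}$ if every element of $\mathcal{B}$ commutes with every element of $\mathcal{A}$ (so every element of $\mathcal{B}$ is normal). With $M(A) = \inf\{\|A-B\| : B \in \mathcal{B}\}$, an element $A \in \mathcal{A}$ is same-norm approximatable in $\mathcal{B}$ if for every $\varepsilon > 0$ there is a $B \in \mathcal{B}$ with $\|B\| \leq \|A\|$ and $\|A-B\| < M(A) + \varepsilon$; $\mathcal{B}$ has the same-norm approximation property in $\mathcal{A}$ if every element of $\mathcal{A}$ is same-norm approximatable in $\mathcal{B}$. The radial retraction of a normal element $F$ to the ball of radius $r \ge 0$ is $G = g_r(F)$, where $g_r : \mathbb{C} \to \mathbb{C}$ is the continuous function $g_r(z) = z$ if $|z| \leq r$ and $g_r(z) = r z/|z|$ if $|z| > r$ (note $g_r(0)=0$). *)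

(* Defs.v *)
From HB Require Import structures.
From mathcomp Require Import all_boot all_order all_algebra.
From mathcomp Require Import complex.
From mathcomp Require Import all_classical all_reals.
From mathcomp Require Import topology normedtype.

Set Implicit Arguments.
Unset Strict Implicit.
Unset Printing Implicit Defensive.

Import Order.TTheory GRing.Theory Num.Theory.
Import numFieldNormedType.Exports.

Local Open Scope classical_set_scope.
Local Open Scope ring_scope.

(* Algebras are not assumed to have a unit, so the ring structures of MathComp,
   which all have a 1, cannot carry the multiplication. *)
HB.mixin Record CompleteNormedModule_isCstarAlgebra (R : realType) A
    of CompleteNormedModule R[i] A := {
  cmul : A -> A -> A;
  cstar : A -> A;
  cmulA : associative cmul;
  cmulDl : left_distributive cmul +%R;
  cmulDr : right_distributive cmul +%R;
  cscaleAl : forall (k : R[i]) (a b : A), k *: cmul a b = cmul (k *: a) b;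
  cscaleAr : forall (k : R[i]) (a b : A), k *: cmul a b = cmul a (k *: b);
  cstarD : {morph cstar : a b / a + b};
  cstarZ : forall (k : R[i]) (a : A), cstar (k *: a) = k^* *: cstar a;
  cstarM : forall a b : A, cstar (cmul a b) = cmul (cstar b) (cstar a);
  cstarK : involutive cstar;
  cnormM : forall a b : A, `|cmul a b| <= `|a| * `|b|;
  cnorm_star : forall a : A, `|cmul (cstar a) a| = `|a| ^+ 2
}.

#[short(type="cstarAlgType")]
HB.structure Definition CstarAlgebra (R : realType) :=
  { A of CompleteNormedModule R[i] A
       & CompleteNormedModule_isCstarAlgebra R A }.

Section CstarAlgebraTheory.
Variables (R : realType) (A : cstarAlgType R).
Implicit Types (a b F G : A) (B : set A).

(* The norm of a normed module over R[i] takes its (real, nonnegative) values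
   in R[i]; [nrm] is the same norm with values in R. *)
Definition nrm a : R := complex.Re `|a|.

Definition is_cstar_subalgebra B : Prop :=
  B 0 /\
  (forall a b, B a -> B b -> B (a + b)) /\
  (forall (k : R[i]) a, B a -> B (k *: a)) /\
  (forall a b, B a -> B b -> B (cmul a b)) /\
  (forall a, B a -> B (cstar a)) /\
  closed B.

Definition central B : Prop :=
  forall b a, B b -> cmul b a = cmul a b.

Definition best_approx B a : R := inf [set nrm (a - b) | b in B].

Definition same_norm_approximatable B a : Prop :=
  forall eps : R, 0 < eps ->
    exists b, B b /\ nrm b <= nrm a /\ nrm (a - b) < best_approx B a + eps.

Definition same_norm_approximation_property B : Prop :=
  forall a, same_norm_approximatable B a.

(* (k, a) : R[i] * A stands for the element k 1 + a of the unitization of A;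
   its unit is (1, 0). *)
Definition unitization_mul (x y : R[i] * A) : R[i] * A :=
  (x.1 * y.1, x.1 *: y.2 + y.1 *: x.2 + cmul x.2 y.2).

(* Spectrum of an element F of the C*-algebra B, computed in the unitization
   of B; it always contains 0. *)
Definition spectrum B F : set R[i] :=
  [set l | ~ exists y : R[i] * A,
     [/\ B y.2,
         unitization_mul (l, - F) y = (1, 0) &
         unitization_mul y (l, - F) = (1, 0)]].

Definition cfc_dom B F (f : R[i] -> R[i]) : Prop :=
  {within (spectrum B F : set (R[i])^o),
     continuous (f : (R[i])^o -> (R[i])^o)} /\ f 0 = 0.

(* [Phi] is a *-homomorphism into B, sending the identity function to F, from
   the algebra of continuous functions on the spectrum of F that vanish at 0.
   Such a function is represented by any f : R[i] -> R[i] extending it,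
   whence [cfc_ext]. When F is normal there is exactly one such
   *-homomorphism. If B has a unit, its spectrum relative to that unit differs
   from [spectrum B F] at most by 0, and the two functional calculi agree on
   functions vanishing at 0. *)
Record is_cfc B F (Phi : (R[i] -> R[i]) -> A) : Prop := IsCfc {
  cfc_mem : forall f, cfc_dom B F f -> B (Phi f);
  cfc_ext : forall f g, cfc_dom B F f -> cfc_dom B F g ->
    (forall z, spectrum B F z -> f z = g z) -> Phi f = Phi g;
  cfcD : forall f g, cfc_dom B F f -> cfc_dom B F g ->
    Phi (fun z => f z + g z) = Phi f + Phi g;
  cfcZ : forall (k : R[i]) f, cfc_dom B F f ->
    Phi (fun z => k * f z) = k *: Phi f;
  cfcM : forall f g, cfc_dom B F f -> cfc_dom B F g ->
    Phi (fun z => f z * g z) = cmul (Phi f) (Phi g);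
  cfc_star : forall f, cfc_dom B F f ->
    Phi (fun z => (f z)^*) = cstar (Phi f);
  cfc_id : Phi (fun z => z) = F
}.

(* f(F); the default value 0 is irrelevant for F normal in B and f in
   [cfc_dom B F], where the functional calculus exists and is unique. *)
Definition cfc B F (f : R[i] -> R[i]) : A :=
  xget 0 [set G | exists2 Phi, is_cfc B F Phi & Phi f = G].

Definition radial (r : R) (z : R[i]) : R[i] :=
  if `|z| <= r%:C%C then z else r%:C%C * z / `|z|.

Definition radial_retraction B (r : R) F : A := cfc B F (radial r).

End CstarAlgebraTheory.

(* Main.v *)
Require Import Defs.
From HB Require Import structures.
From mathcomp Require Import all_boot all_order all_algebra.
From mathcomp Require Import complex.
From mathcomp Require Import all_classical all_reals.
From mathcomp Require Import topology normedtype.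
From mathcomp Require Import sequences derive realfun.
From mathcomp Require Import ring lra.

Set Implicit Arguments.
Unset Strict Implicit.
Unset Printing Implicit Defensive.

Import Order.TTheory GRing.Theory Num.Theory.
Import numFieldNormedType.Exports.

Local Open Scope classical_set_scope.
Local Open Scope ring_scope.

(** Write [r = |a|], where [r > 0] without loss of generality, and let [k >= 0]
    be the function [max(|z|/r, 1) - 1] of [F]. Then [F = G + k G] and [k G^* G = r^2 k], as [k] lives where [|z| > r] and there
    [|G| = r]. Since [F] and its functions are central, with [d = a - G],
<<
  (a - F)^* (a - F) = d^* d + k d^* d + k^2 G^* G + k (r^2 - a^* a).
>>
    Every term on the right is positive, and the norm is monotone on positive
    elements, so [|a - F|^2 >= |d|^2] ([norm_sub_retraction_le]). Likewise
    [|G| <= r] because [r^2 - G^* G] is a square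
    ([norm_le_of_sqr_complement]). These arguments only use the algebraic laws of
    a functional calculus, so that they apply to whichever one is picked; that
    there is one at all has to be proved too.

    Everything rests on the supply of characters. In a commutative star-algebra
    with a C*-seminorm [N], consider the C*-seminorms [p <= N] that satisfy
    [p (x b) = p x N b], for a fixed selfadjoint [b]. A minimal one is
    multiplicative, for otherwise localizing it at some [h], that is, replacing
    [p x] by [inf_n p (x h^n) / (p h)^n], would make it smaller
    ([multiplicative_attaining_exists]). By an elementary form of the Gelfand-Mazur
    theorem (the factorization of [y^n - k^n]) every element is a scalar
    modulo a multiplicative seminorm, and this scalar is a character that attains
    the norm of [b] ([character_attains]).

    Positivity follows: an element is positive when it is so on the
    characters of its bicommutant, which amounts to [|t - h| <= t] for some [t], a
    condition stable under sums. Kaplansky's theorem that [x^* x] is positive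
    ([pos_star_mul]) is the step that leaves commutative subalgebras.

    The functional calculus of [F] sends [f] to the element on which every
    character [chi] takes the value [f (chi F)]. The functions for which it
    exists form an algebra closed under conjugation, uniform limits and inverses of
    functions bounded below; hence the spectrum is compact, and averages against
    polynomial bumps show that every continuous function is one of them
    ([continuous_in_calculus]). All this takes place in the unitization, normed by
    [unit_norm]. *)

(** * Moduli of complex numbers and compactness in the complex plane *)

Section Modulus.
Variable R : realType.
Implicit Types z w : R[i].

Definition cabs z : R := complex.Re `|z|.

Lemma cabsE z : (cabs z)%:C%C = `|z|.
Proof. by rewrite RRe_real ?normr_real. Qed.

Lemma cabs_ge0 z : 0 <= cabs z.
Proof. by rewrite -ler0c cabsE. Qed.

Lemma cabsM z w : cabs (z * w) = cabs z * cabs w.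
Proof. by apply: complexI; rewrite rmorphM /= !cabsE normrM. Qed.

Lemma cabsD z w : cabs (z + w) <= cabs z + cabs w.
Proof. by rewrite -lecR rmorphD /= !cabsE ler_normD. Qed.

Lemma cabsN z : cabs (- z) = cabs z.
Proof. by rewrite /cabs normrN. Qed.

Lemma cabsB z w : cabs (z - w) = cabs (w - z).
Proof. by rewrite /cabs distrC. Qed.

Lemma cabs1 : cabs 1 = 1.
Proof. by rewrite /cabs normr1. Qed.

Lemma cabs0 : cabs 0 = 0.
Proof. by rewrite /cabs normr0. Qed.

Lemma cabs_eq0 z : cabs z = 0 -> z = 0.
Proof. by move=> z0; apply/normr0_eq0; rewrite -cabsE z0. Qed.

Lemma cabsX z n : cabs (z ^+ n) = cabs z ^+ n.
Proof. by apply: complexI; rewrite rmorphXn /= !cabsE normrX. Qed.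

Lemma cabs_conj z : cabs z^* = cabs z.
Proof. by rewrite /cabs norm_conjC. Qed.

Lemma cabsR (x : R) : cabs x%:C%C = `|x|.
Proof. by rewrite /cabs normc_def /= expr0n addr0 sqrtr_sqr. Qed.

Lemma conj_real_complex (x : R) : (x%:C%C)^* = x%:C%C.
Proof. exact: conjc_real. Qed.

Lemma cabs_sqr z : ((cabs z ^+ 2)%:C)%C = z * z^*.
Proof. by rewrite rmorphXn /= cabsE normCK. Qed.

Lemma cabs_sum I (r : seq I) (P : pred I) (F : I -> R[i]) :
  cabs (\sum_(i <- r | P i) F i) <= \sum_(i <- r | P i) cabs (F i).
Proof.
elim/big_ind2 : _ => [|x1 x2 y1 y2 h1 h2|//]; first by rewrite cabs0.
exact: le_trans (cabsD _ _) (lerD h1 h2).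
Qed.

Lemma ltr_norm_cabs z (e : R) : (`|z| < e%:C%C) = (cabs z < e).
Proof. by rewrite -ltcR cabsE. Qed.

Lemma ler_norm_cabs z (e : R) : (`|z| <= e%:C%C) = (cabs z <= e).
Proof. by rewrite -lecR cabsE. Qed.

Lemma nbhs_complexP (z : R[i]^o) (A : set R[i]^o) :
  nbhs z A <-> exists2 e : R, 0 < e & forall w : R[i], cabs (w - z) < e -> A w.
Proof.
split=> [/nbhs_normP[e /= e0 zA]|[e e0 zA]].
  exists (cabs e).
    by rewrite -ltcR cabsE gtr0_norm.
  move=> w wz; apply: zA => /=.
  by rewrite distrC -[X in _ < X]gtr0_norm// -cabsE ltr_norm_cabs.
apply/nbhs_ballP; exists e%:C%C => /=; first by rewrite ltcR.
by move=> w; rewrite /ball /= distrC ltr_norm_cabs => /zA.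
Qed.

Lemma cabs_continuous : continuous (cabs : R[i]^o -> R^o).
Proof.
move=> z A /nbhs_ballP[e e0 eA]; apply/nbhs_complexP; exists e => // w wz.
apply: eA.
have h1 := cabsD (w - z) z; have h2 := cabsD (z - w) w.
rewrite subrK in h1; rewrite subrK cabsB in h2.
by rewrite /ball /= ltr_norml; lra.
Qed.

Lemma real_complex_continuous : continuous (fun x : R^o => x%:C%C : R[i]^o).
Proof.
move=> x A /nbhs_complexP[e e0 xA].
suff : nbhs (x : R^o) [set y : R | `|x - y| < e].
  apply: filterS => y /= xy; apply: xA.
  by rewrite -rmorphB /= cabsR distrC.
by apply/nbhs_ballP; exists e.
Qed.

Lemma compact_square (r : R) : compact
  ((fun xy : R * R => (xy.1 +i* xy.2)%C : R[i]^o) @` (`[-r, r]%classic `*` `[-r, r]%classic)).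
Proof.
apply: continuous_compact; last by apply: compact_setX; exact: segment_compact.
apply: continuous_subspaceT => -[x y].
have -> : (fun xy : R * R => (xy.1 +i* xy.2)%C : R[i]^o) =
    (fun xy : R * R => (xy.1%:C%C : R[i]^o) + ('i)%C * (xy.2%:C%C : R[i]^o)).
  by apply/funext => -[a b] /=; rewrite [LHS]complexE.
apply: cvgD.
  apply: (@continuous_comp (R^o * R^o)%type R^o R[i]^o fst); first exact: cvg_fst.
  exact: real_complex_continuous.
apply: cvgM; first exact: cvg_cst.
apply: (@continuous_comp (R^o * R^o)%type R^o R[i]^o snd); first exact: cvg_snd.
exact: real_complex_continuous.
Qed.

Lemma complex_compact (K : set R[i]^o) (r : R) :
  closed K -> (forall z, K z -> cabs z <= r) -> compact K.
Proof.
move=> Kcl Kr; apply: (subclosed_compact Kcl (@compact_square r)).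
move=> [x y] /Kr; rewrite /cabs normc_def /= => xyr.
have r0 : 0 <= r by apply: le_trans xyr; exact: sqrtr_ge0.
have {xyr} xyr : x ^+ 2 + y ^+ 2 <= r ^+ 2.
  rewrite -(@ler_sqrt _ _ (r ^+ 2)) ?sqr_ge0// sqrtr_sqr ger0_norm//.
have X2 := sqr_ge0 x; have Y2 := sqr_ge0 y.
exists (x, y) => //=; split => /=; rewrite in_itv /= -ler_norml.
- by rewrite -(@ler_pXn2r _ 2) ?nnegrE // real_normK ?num_real//; lra.
- by rewrite -(@ler_pXn2r _ 2) ?nnegrE // real_normK ?num_real//; lra.
Qed.

(** The growth condition confines the infimum to a disc. *)
Lemma complex_min_attained (f : R[i] -> R) (c : R) :
  (forall z w, f z <= f w + cabs (z - w)) -> (forall z, cabs z <= f z + c) ->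
  exists z, forall w, f z <= f w.
Proof.
move=> f_lip f_grow.
pose K : set R[i]^o := [set z | cabs z <= f 0 + c].
have K0 : K 0 by rewrite /K /=; apply: f_grow.
have Kcl : closed K.
  rewrite [K](_ : _ = cabs @^-1` [set x : R | x <= f 0 + c])//.
  apply: (closed_comp (f := cabs : R[i]^o -> R^o)); last exact: closed_le.
  by move=> z _; exact: cabs_continuous.
have f_cont : continuous (f : R[i]^o -> R^o).
  move=> z A /nbhs_ballP[e e0 eA]; apply/nbhs_complexP; exists e => // w wz.
  apply: eA; rewrite /ball /=.
  have := f_lip z w; have := f_lip w z; rewrite (cabsB z w) /= ltr_norml; lra.
have [z _ zmin] := compact_EVT_min (ex_intro _ _ K0)
  (complex_compact Kcl (fun _ h => h)) (continuous_subspaceT f_cont).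
exists z => w; have [|wK] := lerP (cabs w) (f 0 + c).
  by move=> wK; apply: zmin; rewrite inE.
have /zmin : (0 : R[i]^o) \in K by rewrite inE.
have := f_grow w; move: wK => /=; lra.
Qed.

Lemma compact_uniform_modulus (K : set R[i]^o) (f : R[i]^o -> R[i]^o) (e : R) :
  compact K -> {within K, continuous f} -> 0 < e ->
  exists2 d : R, 0 < d &
    forall z w, K z -> K w -> cabs (z - w) < d -> cabs (f z - f w) <= e.
Proof.
move=> Kc fc e0.
have e20 : 0 < e / 2 by rewrite divr_gt0.
pose P (d : R) (z : R[i]^o) :=
  forall w, K w -> K z -> cabs (z - w) < d -> cabs (f z - f w) <= e.
have := proj1 (compact_near_coveringP K) Kc R (0^'+) P _.
move=> /(_ _)[].
  move=> z Kz; move/subspace_continuousP : fc => /(_ z Kz).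
  move=> /(_ [set w : R[i]^o | cabs (w - f z) < e / 2]).
  have /[swap]/[apply] : nbhs (f z) [set w : R[i]^o | cabs (w - f z) < e / 2].
    by apply/nbhs_complexP; exists (e / 2).
  move=> /nbhs_complexP[d d0 hd].
  have d20 : 0 < d / 2 by rewrite divr_gt0.
  have hd' w : K w -> cabs (w - z) < d -> cabs (f z - f w) < e / 2.
    by move=> Kw wz; rewrite cabsB; exact: (hd w wz Kw).
  exists ([set w | cabs (w - z) < d / 2], [set d' | d' < d / 2]).
    split; first by apply/nbhs_complexP; exists (d / 2).
    by near=> d' => /=; near: d'; apply: nbhs_right_lt.
  move=> [w d'] /= [wz d'd] v Kv Kw wv.
  have h1 := hd' w Kw; have h2 := hd' v Kv.
  have h3 := cabsD (v - w) (w - z); rewrite addrA subrK in h3.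
  have h4 := cabsD (f w - f z) (f z - f v); rewrite addrA subrK in h4.
  move: h1 h2 h3 h4; rewrite (cabsB v w) (cabsB (f w) (f z)).
  move=> h1 h2 h3 h4.
  have := h1 _; have := h2 _; lra.
move=> d /= d0 hd.
exists (d / 2).
  by rewrite divr_gt0.
move=> z w Kz Kw zw.
apply: (hd (d / 2) _ _ z Kz w Kw Kz zw) => /=.
  rewrite sub0r normrN gtr0_norm ?divr_gt0//. lra.
by rewrite divr_gt0.
Unshelve. all: by end_near. Qed.

Lemma compact_finite_net (K : set R[i]^o) (d : R) : compact K -> 0 < d ->
  exists2 s : seq R[i], (forall w, w \in s -> K w) &
    forall z, K z -> exists2 w, w \in s & cabs (z - w) < d.
Proof.
move=> Kc d0.
have := Kc; rewrite compact_cover => /(_ R[i] K (fun w => (ball (w : R[i]^o) (d%:C)%C)^°)).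
move=> [].
- by move=> i _; exact: open_interior.
- move=> z Kz; exists z => //; apply/nbhs_complexP; exists d => // w wz.
  by rewrite /ball /= distrC ltr_norm_cabs.
move=> D DK cov; exists (finmap.enum_fset D).
  by move=> w /DK; rewrite inE.
move=> z /cov[w /= wD zw]; exists w => //.
have := interior_subset zw.
by rewrite /ball /= distrC ltr_norm_cabs.
Qed.

Lemma exists_expr_lt (q e : R) : 0 <= q -> q < 1 -> 0 < e -> exists n, q ^+ n < e.
Proof.
move=> q0 q1 e0; have qn : `|q| < 1 by rewrite ger0_norm.
have := @cvgr0_norm_lt _ _ _ _ _ _ (cvg_expr qn) _ e0.
move=> [n _ /(_ n (leqnn n)) /=]; rewrite ger0_norm ?exprn_ge0// => qne.
by exists n.
Qed.
End Modulus.

(** * Stars, C*-seminorms and their localization *)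

Section Star.
Variables (R : realType) (U : algType R[i]) (star : U -> U).
Implicit Types (C : set U) (p : U -> R) (x y : U).

Record is_star : Prop := IsStar {
  starD : {morph star : x y / x + y};
  starZ : forall (k : R[i]) x, star (k *: x) = k^* *: star x;
  starM : forall x y, star (x * y) = star y * star x;
  starK : involutive star }.

(** Commutative subalgebras are carried as sets of elements of one ambient
    algebra, because positivity compares elements that do not commute. *)
Record star_subalgebra C : Prop := StarSubalgebra {
  sub1 : C 1;
  subD : forall x y, C x -> C y -> C (x + y);
  subZ : forall (k : R[i]) x, C x -> C (k *: x);
  subM : forall x y, C x -> C y -> C (x * y);
  sub_star : forall x, C x -> C (star x) }.

Definition commutative_set C := forall x y, C x -> C y -> x * y = y * x.

(** The laws are required on [C] only: the seminorms that lead to characters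
    exist on commutative subalgebras. The reverse inequality in the
    C*-identity is [sn_star]. *)
Record cstar_seminorm C p : Prop := CstarSeminorm {
  sn_ge0 : forall x, C x -> 0 <= p x;
  snD : forall x y, C x -> C y -> p (x + y) <= p x + p y;
  snZ : forall (k : R[i]) x, C x -> p (k *: x) = cabs k * p x;
  snM : forall x y, C x -> C y -> p (x * y) <= p x * p y;
  sn1 : p 1 = 1;
  sn_star_ge : forall x, C x -> p x ^+ 2 <= p (star x * x) }.

Section StarTheory.
Hypothesis Hs : is_star.

Lemma star0 : star 0 = 0.
Proof. by have := starZ Hs 0 0; rewrite conjC0 !scale0r. Qed.

Lemma starN x : star (- x) = - star x.
Proof. by apply/eqP; rewrite -addr_eq0 -(starD Hs) addNr star0. Qed.

Lemma starB x y : star (x - y) = star x - star y.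
Proof. by rewrite (starD Hs) starN. Qed.

Lemma star1 : star 1 = 1.
Proof. by have := starM Hs (star 1) 1; rewrite !(starK Hs, mulr1) => <-. Qed.

Lemma starA (k : R[i]) : star k%:A = (k^*)%:A.
Proof. by rewrite (starZ Hs) star1. Qed.

Lemma starX x n : star (x ^+ n) = star x ^+ n.
Proof.
elim: n => [|n IH]; first by rewrite !expr0 star1.
by rewrite exprS (starM Hs) IH -exprSr.
Qed.
End StarTheory.

Section SubTheory.
Variable C : set U.
Hypothesis HC : star_subalgebra C.

Lemma subA k : C k%:A.
Proof. exact: subZ (sub1 HC). Qed.

Lemma sub0 : C 0.
Proof. by have := subA 0; rewrite scale0r. Qed.

Lemma subN x : C x -> C (- x).
Proof. by rewrite -scaleN1r; exact: subZ. Qed.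

Lemma subB x y : C x -> C y -> C (x - y).
Proof. by move=> Cx /subN; exact: subD. Qed.

Lemma subX x n : C x -> C (x ^+ n).
Proof.
move=> Cx; elim: n => [|n IH]; first by rewrite expr0; exact: sub1 HC.
by rewrite exprS; exact: subM.
Qed.

End SubTheory.
End Star.

Ltac memC H := repeat first
  [ assumption | exact: (sub1 H) | exact: (sub0 H) | exact: (subA H)
  | apply: (subB H) | apply: (subD H) | apply: (subN H) | apply: (subM H)
  | apply: (subZ H) | apply: (subX H) | apply: (sub_star H)].

Section Seminorm.
Variables (R : realType) (U : algType R[i]) (star : U -> U) (C : set U).
Hypotheses (Hs : is_star star) (HC : star_subalgebra star C).
Implicit Types (p : U -> R) (x y : U).

Lemma eq_sqr_ge0 (a b : R) : 0 <= a -> 0 <= b -> a ^+ 2 = b ^+ 2 -> a = b.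
Proof. by move=> a0 b0 /eqP; rewrite eqrXn2// => /eqP. Qed.

Lemma inf_ge_scale (I : Type) (i0 : I) (a : I -> R) (c k : R) :
  0 <= k -> (forall i, 0 <= a i) -> (forall i, c <= k * a i) ->
  c <= k * inf (range a).
Proof.
move=> k0 a0 ck.
have [k00|kn0] := eqVneq k 0; first by have := ck i0; rewrite k00 !mul0r.
have k_gt0 : 0 < k by rewrite lt_neqAle eq_sym kn0.
rewrite -ler_pdivrMl//; apply: lb_le_inf; first by exists (a i0), i0.
by move=> _ [i _ <-]; rewrite ler_pdivrMl.
Qed.

Lemma inf_range_le (I : Type) (a : I -> R) i :
  (forall i, 0 <= a i) -> inf (range a) <= a i.
Proof.
move=> a0; apply: ge_inf; last by exists i.
by exists 0 => _ [j _ <-].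
Qed.

Lemma mulrACA_comm (a b c d : U) : b * c = c * b -> a * b * (c * d) = a * c * (b * d).
Proof. by move=> bc; rewrite -mulrA (mulrA b) bc -!mulrA. Qed.

Section OneSeminorm.
Variable p : U -> R.
Hypothesis Hp : cstar_seminorm star C p.

Lemma sn0 : p 0 = 0.
Proof. by have := snZ Hp 0 (sub1 HC); rewrite scale0r cabs0 mul0r. Qed.

Lemma snN x : C x -> p (- x) = p x.
Proof. by move=> Cx; rewrite -scaleN1r (snZ Hp)// cabsN cabs1 mul1r. Qed.

Lemma snB x y : C x -> C y -> p (x - y) <= p x + p y.
Proof. by move=> Cx Cy; rewrite -(snN Cy); apply: (snD Hp) => //; memC HC. Qed.

Lemma snA k : p k%:A = cabs k.
Proof. by rewrite (snZ Hp) ?(sn1 Hp) ?mulr1//; memC HC. Qed.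

Lemma sn_starE x : C x -> p (star x) = p x.
Proof.
have le_star y : C y -> p y <= p (star y).
  move=> Cy; have Csy : C (star y) by memC HC.
  have y0 := sn_ge0 Hp Cy; have sy0 := sn_ge0 Hp Csy.
  have := le_trans (sn_star_ge Hp Cy) (snM Hp Csy Cy); nra.
move=> Cx; apply/eqP; rewrite eq_le le_star// andbT.
by rewrite -[in leRHS](starK Hs x) le_star//; memC HC.
Qed.

Lemma sn_star x : C x -> p (star x * x) = p x ^+ 2.
Proof.
move=> Cx; apply/eqP; rewrite eq_le (sn_star_ge Hp)// andbT.
rewrite expr2 -{1}(sn_starE Cx); apply: (snM Hp) => //; memC HC.
Qed.

Lemma snX x n : C x -> p (x ^+ n) <= p x ^+ n.
Proof.
move=> Cx; elim: n => [|n IH]; first by rewrite !expr0 (sn1 Hp).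
rewrite !exprS; apply: (le_trans (snM Hp Cx _)); first by memC HC.
by apply: ler_wpM2l IH; exact: (sn_ge0 Hp).
Qed.

(** The C*-identity gives this for powers of two; submultiplicativity
    interpolates. *)
Lemma sn_selfadjX h n : C h -> star h = h -> p (h ^+ n) = p h ^+ n.
Proof.
move=> Ch hh; have h0 := sn_ge0 Hp Ch.
have pow2 k : p (h ^+ (2 ^ k)) = p h ^+ (2 ^ k).
  elim: k => [|k IH]; first by rewrite !expr1.
  rewrite expnS mulnC exprM [in RHS]exprM -IH -sn_star; last by memC HC.
  by rewrite (starX Hs) hh -expr2.
apply/eqP; rewrite eq_le snX//=.
have [ph0|pn0] := eqVneq (p h) 0.
  rewrite ph0; case: n => [|n]; first by rewrite !expr0 (sn1 Hp).
  by rewrite expr0n /= (sn_ge0 Hp)//; memC HC.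
have ph_gt0 : 0 < p h by rewrite lt_neqAle eq_sym pn0.
have n2 : (n <= 2 ^ n)%N by apply: ltnW; exact: ltn_expl.
rewrite -(ler_pM2r (exprn_gt0 (2 ^ n - n) ph_gt0)) -exprD subnKC// -pow2.
rewrite -[in leLHS](subnKC n2) exprD.
apply: (le_trans (snM Hp _ _)); [by memC HC|by memC HC|].
apply: ler_wpM2l; first by apply: (sn_ge0 Hp); memC HC.
by apply: snX.
Qed.
End OneSeminorm.

(** The pointwise infimum of a downward directed family of seminorms, each
    of which satisfies submultiplicativity and the C*-identity only up to
    passing further down the family. *)
Lemma inf_cstar_seminorm (I : Type) (i0 : I) (f : I -> U -> R) :
  (forall i j, exists k, forall x, C x -> f k x <= f i x /\ f k x <= f j x) ->
  (forall i x, C x -> 0 <= f i x) ->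
  (forall i x y, C x -> C y -> f i (x + y) <= f i x + f i y) ->
  (forall i k x, C x -> f i (k *: x) = cabs k * f i x) ->
  (forall i, f i 1 = 1) ->
  (forall i, exists k, forall x y, C x -> C y -> f k (x * y) <= f i x * f i y) ->
  (forall i, exists k, forall x, C x -> f k x ^+ 2 <= f i (star x * x)) ->
  cstar_seminorm star C (fun x => inf (range (f ^~ x))).
Proof.
move=> dir f0 fD fZ f1 fM fs.
have le_f i x : C x -> inf (range (f ^~ x)) <= f i x.
  by move=> Cx; apply: (@inf_range_le _ (f ^~ x)) => j; exact: f0.
have inf0 x : C x -> 0 <= inf (range (f ^~ x)).
  by move=> Cx; apply: lb_le_inf; [exists (f i0 x), i0|move=> _ [i _ <-]; exact: f0].
have glb c x : (forall i, c <= f i x) -> c <= inf (range (f ^~ x)).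
  by move=> cf; apply: lb_le_inf; [exists (f i0 x), i0|move=> _ [i _ <-]].
split => //.
- move=> x y Cx Cy; rewrite /= -lerBlDr; apply: (glb) => i.
  rewrite lerBlDr -lerBlDl; apply: (glb) => j; rewrite lerBlDl.
  have [k hk] := dir i j; apply: (le_trans (le_f k _ _)); first by memC HC.
  apply: (le_trans (fD _ _ _ _ _)) => //.
  by apply: lerD; [have [] := hk x Cx|have [] := hk y Cy].
- move=> k x Cx; apply/eqP; rewrite /= eq_le; apply/andP; split.
    apply: inf_ge_scale => //; first exact: cabs_ge0.
      by move=> i; exact: f0.
    by move=> i; rewrite -fZ//; apply: le_f; memC HC.
  apply: (glb) => i; rewrite fZ//; apply: ler_wpM2l; first exact: cabs_ge0.
  exact: le_f.
- move=> x y Cx Cy /=; apply: inf_ge_scale => // [|j|j]; [exact: inf0|exact: f0|rewrite mulrC].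
  apply: inf_ge_scale => // [|i|i]; [exact: f0|exact: f0|rewrite mulrC].
  have [k hk] := dir i j; have [l hl] := fM k.
  apply: (le_trans (le_f l _ _)); first by memC HC.
  apply: (le_trans (hl x y Cx Cy)).
  by apply: ler_pM; [exact: f0|exact: f0|have [] := hk x Cx|have [] := hk y Cy].
- apply/eqP; rewrite eq_le; apply/andP; split.
    by rewrite -[leRHS](f1 i0); apply: le_f; memC HC.
  by apply: (glb) => i; rewrite f1.
- move=> x Cx /=; apply: (glb) => i; have [k hk] := fs i.
  by apply: le_trans (hk x Cx); rewrite ler_pXn2r ?nnegrE ?inf0 ?f0 ?le_f.
Qed.

Hypothesis commC : commutative_set C.

(** For [p] the supremum norm over a space of characters, this is the supremum over
    the characters at which [|h|] is maximal. *)
Definition localized p h x := inf (range (fun n : nat => p (x * h ^+ n) / p h ^+ n)).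

Section Localization.
Variables (p : U -> R) (h : U).
Hypotheses (Hp : cstar_seminorm star C p) (Ch : C h) (hh : star h = h).
Hypothesis ph_gt0 : 0 < p h.

Let g n x := p (x * h ^+ n) / p h ^+ n.

Let Chn n : C (h ^+ n).
Proof. by memC HC. Qed.

Let phn n : 0 < p h ^+ n.
Proof. exact: exprn_gt0. Qed.

Let gS n x : C x -> g n.+1 x <= g n x.
Proof.
move=> Cx; rewrite /g ler_pdivrMr// exprSr mulrA exprSr mulrA divfK ?gt_eqF//.
by apply: (snM Hp) => //; memC HC.
Qed.

Let g_anti m n x : C x -> (m <= n)%N -> g n x <= g m x.
Proof.
move=> Cx; elim: n => [|n IH]; first by rewrite leqn0 => /eqP ->.
rewrite leq_eqVlt => /predU1P[->//|]; rewrite ltnS => /IH; apply: le_trans.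
exact: gS.
Qed.

Let g_ge0 n x : C x -> 0 <= g n x.
Proof.
by move=> Cx; apply: divr_ge0; [apply: (sn_ge0 Hp); memC HC|exact: ltW].
Qed.

Lemma localized_le x : C x -> localized p h x <= p x.
Proof.
move=> Cx; rewrite (_ : p x = g 0 x); last by rewrite /g !expr0 mulr1 divr1.
by apply: (@inf_range_le _ (fun n => g n x)) => n; exact: g_ge0.
Qed.

Lemma localized_seminorm : cstar_seminorm star C (localized p h).
Proof.
rewrite (_ : localized p h = fun x => inf (range (g ^~ x)))//.
apply: (inf_cstar_seminorm 0%N).
- move=> i j; exists (maxn i j) => x Cx.
  by split; apply: g_anti => //; [exact: leq_maxl|exact: leq_maxr].
- by move=> i x; exact: g_ge0.
- move=> i x y Cx Cy; rewrite /g -mulrDl ler_pM2r ?invr_gt0// mulrDl.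
  by apply: (snD Hp); memC HC.
- move=> i k x Cx; rewrite /g -scalerAl (snZ Hp) ?mulrA//; memC HC.
- by move=> i; rewrite /g mul1r (sn_selfadjX Hp)// divff// gt_eqF.
- move=> i; exists (i + i)%N => x y Cx Cy; rewrite /g mulf_div -exprD ler_pM2r ?invr_gt0//.
  rewrite [in leLHS]exprD mulrACA_comm; last exact: commC.
  by apply: (snM Hp); memC HC.
- move=> i; exists i => x Cx; apply: le_trans (_ : g (i + i) (star x * x) <= _); last first.
    by apply: g_anti; [memC HC|exact: leq_addr].
  rewrite /g expr_div_n -(sn_star Hp); last by memC HC.
  rewrite -exprM muln2 -addnn (starM Hs) (starX Hs) hh (commC (Chn i)); last by memC HC.
  by rewrite mulrACA_comm ?exprD//; apply: commC.
Qed.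

(** Localization keeps the elements by which [p] is already multiplicative. *)
Lemma localized_mul x b (k : R) : C x -> 0 <= k ->
  (forall y, C y -> p (y * b) = p y * k) -> C b ->
  localized p h (x * b) = localized p h x * k.
Proof.
move=> Cx k0 pb Cb.
have gb n : g n (x * b) = g n x * k.
  by rewrite /g -mulrA (commC Cb (Chn n)) mulrA pb 1?mulrAC//; memC HC.
have g_le n y : C y -> localized p h y <= g n y.
  by move=> Cy; apply: (@inf_range_le _ (g ^~ y)) => j; exact: g_ge0.
rewrite mulrC; apply/eqP; rewrite eq_le; apply/andP; split.
  apply: (inf_ge_scale 0%N) => // [i|i]; first exact: g_ge0.
  by rewrite mulrC -gb g_le//; memC HC.
apply: lb_le_inf; first by exists (g 0 (x * b)), 0%N.
by move=> _ [n _ <-]; rewrite -/(g n (x * b)) gb mulrC ler_wpM2r// g_le.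
Qed.

Lemma localized_mul_self x : C x -> localized p h (x * h) = localized p h x * p h.
Proof.
move=> Cx.
have gh n : g n (x * h) = g n.+1 x * p h.
  by rewrite /g -mulrA -exprS [p h ^+ n.+1]exprSr invfM mulrA divfK ?gt_eqF.
have g_le n y : C y -> localized p h y <= g n y.
  by move=> Cy; apply: (@inf_range_le _ (g ^~ y)) => j; exact: g_ge0.
rewrite mulrC; apply/eqP; rewrite eq_le; apply/andP; split.
  apply: (inf_ge_scale 0%N) => // [|i|i]; [exact: ltW|exact: g_ge0|].
  apply: (le_trans (g_le i _ _)); first by memC HC.
  by rewrite gh mulrC ler_pM2l// gS.
apply: lb_le_inf; first by exists (g 0 (x * h)), 0%N.
by move=> _ [n _ <-]; rewrite -/(g n (x * h)) gh mulrC ler_pM2r// g_le.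
Qed.

End Localization.

Section Minimal.
Variables (N : U -> R) (b : U).
Hypotheses (HN : cstar_seminorm star C N) (Cb : C b) (bb : star b = b).

(** The last condition implies [p b = N b]. Unlike that equality, it survives
    localization. *)
Let attaining p := [/\ cstar_seminorm star C p,
  forall x, C x -> p x <= N x & forall x, C x -> p (x * b) = p x * N b].

Lemma minimal_attaining_exists : 0 < N b -> exists p, attaining p /\
  forall q, attaining q -> (forall x, C x -> q x <= p x) ->
    forall x, C x -> p x <= q x.
Proof.
move=> Nb.
have att0 : attaining (localized N b).
  split; [exact: localized_seminorm|exact: localized_le|].
  exact: localized_mul_self.
pose T := {p | attaining p}.
pose rel_T (s t : T) := `[< forall x, C x -> sval t x <= sval s x >].
have := @ZL_preorder T (exist _ _ att0) rel_T.
case.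
- by move=> t; apply/asboolP.
- move=> r s t /asboolP rs /asboolP st; apply/asboolP => x Cx.
  exact: le_trans (st x Cx) (rs x Cx).
- move=> A Atot; have [[t0 At0]|A0] := pselect (exists t, A t); last first.
    by exists (exist _ _ att0) => s As; case: A0; exists s.
  pose J := {t | A t}; pose j0 : J := exist _ t0 At0.
  pose f (j : J) := sval (sval j).
  have fatt j : attaining (f j) by exact: svalP (sval j).
  have fsn j : cstar_seminorm star C (f j) by have [] := fatt j.
  have f_le j x : C x -> inf (range (f ^~ x)) <= f j x.
    move=> Cx; apply: (@inf_range_le _ (f ^~ x)) => i.
    exact: (sn_ge0 (fsn i)).
  have att : attaining (fun x => inf (range (f ^~ x))).
    split.
    + apply: (inf_cstar_seminorm j0).
      * move=> [i Ai] [j Aj]; have [/asboolP ij|/asboolP ji] := Atot i j Ai Aj.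
          by exists (exist _ j Aj) => x Cx; split=> //; exact: ij.
        by exists (exist _ i Ai) => x Cx; split=> //; exact: ji.
      * by move=> i x; exact: (sn_ge0 (fsn i)).
      * by move=> i x y; exact: (snD (fsn i)).
      * by move=> i k x; exact: (snZ (fsn i)).
      * by move=> i; exact: (sn1 (fsn i)).
      * by move=> i; exists i => x y; exact: (snM (fsn i)).
      * by move=> i; exists i => x; exact: (sn_star_ge (fsn i)).
    + move=> x Cx; apply: (le_trans (f_le j0 x Cx)).
      by have [_ + _] := fatt j0; apply.
    + move=> x Cx; have Nb0 := ltW Nb.
      have fb j : f j (x * b) = f j x * N b by have [_ _] := fatt j; apply.
      rewrite mulrC; apply/eqP; rewrite eq_le; apply/andP; split.
        apply: (inf_ge_scale j0) => // i; first exact: (sn_ge0 (fsn i)).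
        by rewrite mulrC -fb; apply: f_le; memC HC.
      apply: lb_le_inf; first by exists (f j0 (x * b)), j0.
      by move=> _ [i _ <-]; rewrite fb mulrC ler_pM2r// f_le.
  exists (exist _ _ att) => s As; apply/asboolP => x Cx /=.
  exact: (f_le (exist _ s As)).
move=> [p attp] pmax; exists p; split=> // q attq qp.
by have /asboolP := pmax (exist _ q attq) (introT (asboolP _) qp).
Qed.

(** A minimal [p] equals its localization at any selfadjoint [h], which is
    multiplicative by [h]; the C*-identity extends this from [star x * x] to
    [x]. *)
Lemma multiplicative_attaining_exists : 0 < N b -> exists p, [/\ attaining p &
  forall x y, C x -> C y -> p (x * y) = p x * p y].
Proof.
move=> Nb; have [p [attp pmin]] := minimal_attaining_exists Nb.
have [Hp pN pb] := attp.
exists p; split=> //.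
have pself x h : C x -> C h -> star h = h -> p (x * h) = p x * p h.
  move=> Cx Ch hh; have [ph0|ph] := eqVneq (p h) 0.
    apply/eqP; rewrite ph0 mulr0 eq_le (sn_ge0 Hp) ?andbT; last by memC HC.
    by rewrite (le_trans (snM Hp Cx Ch))// ph0 mulr0.
  have ph0 : 0 < p h by rewrite lt_neqAle eq_sym ph (sn_ge0 Hp).
  have le_loc : forall y, C y -> p y <= localized p h y.
    apply: pmin => [|y Cy]; last exact: localized_le.
    split; first exact: localized_seminorm.
      by move=> y Cy; apply: le_trans (pN y Cy); exact: localized_le.
    by move=> y Cy; apply: localized_mul => //; exact: ltW.
  have eq_loc y : C y -> p y = localized p h y.
    by move=> Cy; apply/eqP; rewrite eq_le le_loc//= localized_le.
  rewrite eq_loc; last by memC HC.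
  by rewrite localized_mul_self// -eq_loc.
move=> x y Cx Cy; have x0 := sn_ge0 Hp Cx; have y0 := sn_ge0 Hp Cy.
apply: eq_sqr_ge0; [by apply: (sn_ge0 Hp); memC HC|exact: mulr_ge0|].
rewrite -(sn_star Hp) 1?exprMn; last by memC HC.
rewrite -!(sn_star Hp)// -pself; [|by memC HC|by memC HC|]; last first.
  by rewrite (starM Hs) (starK Hs).
congr p; rewrite (starM Hs) (commC (sub_star HC Cy)); last by memC HC.
by rewrite mulrACA_comm//; apply: commC => //; memC HC.
Qed.

End Minimal.
End Seminorm.

(** * Characters of commutative star-algebras *)

Section Characters.
Variables (R : realType) (U : algType R[i]) (star : U -> U) (C : set U).
Hypotheses (Hs : is_star star) (HC : star_subalgebra star C).
Hypothesis commC : commutative_set C.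
Implicit Types (p N : U -> R) (x y : U) (chi : U -> R[i]).

Record character N chi : Prop := Character {
  chD : forall x y, C x -> C y -> chi (x + y) = chi x + chi y;
  chZ : forall (k : R[i]) x, C x -> chi (k *: x) = k * chi x;
  chM : forall x y, C x -> C y -> chi (x * y) = chi x * chi y;
  ch1 : chi 1 = 1;
  ch_star : forall x, C x -> chi (star x) = (chi x)^*;
  ch_le : forall x, C x -> cabs (chi x) <= N x }.

Section Multiplicative.
Variable p : U -> R.
Hypotheses (Hp : cstar_seminorm star C p)
  (pM : forall x y, C x -> C y -> p (x * y) = p x * p y).

Lemma mult_prod (I : eqType) (s : seq I) (F : I -> U) :
  (forall i, C (F i)) -> p (\prod_(i <- s) F i) = \prod_(i <- s) p (F i).
Proof.
move=> CF; suff [] : C (\prod_(i <- s) F i) /\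
    p (\prod_(i <- s) F i) = \prod_(i <- s) p (F i) by [].
elim: s => [|i s [Cs IH]]; first by rewrite !big_nil (sn1 Hp); split=> //; memC HC.
by rewrite !big_cons pM// IH; split=> //; memC HC.
Qed.

(** If the distance [m] of [y] to the scalars is attained at [0], it is
    attained on a whole disc: [y^n - k^n] factors into [n] terms
    of norm at least [m], one of which is [y - k]. *)
Lemma scalar_distance_step y (k : R[i]) (m : R) : C y -> 0 < m -> p y = m ->
  (forall l : R[i], m <= p (y - l%:A)) -> cabs k = m / 2 ->
  p (y - k%:A) = m.
Proof.
move=> Cy m0 pym m_le km; apply/eqP; rewrite eq_le m_le andbT.
have bound n : p (y - k%:A) <= m + m * (1 / 2) ^+ n.+1.
  pose q : {poly R[i]} := 'X^(n.+1) - (k ^+ n.+1)%:P.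
  have q_monic : q \is monic by exact: monicXnsubC.
  have [r qE] := closed_field_poly_normal q.
  rewrite (monicP q_monic) scale1r in qE.
  have sr : size r = n.+1.
    by apply: succn_inj; rewrite -(size_prod_XsubC r id) -qE size_XnsubC.
  have kr : k \in r.
    by rewrite -root_prod_XsubC -qE rootE !hornerE ?hornerXn subrr.
  have qy : horner_alg y q = y ^+ n.+1 - (k ^+ n.+1)%:A.
    by rewrite rmorphB rmorphXn /= horner_algX horner_algC.
  have : p (horner_alg y q) = \prod_(z <- r) p (y - z%:A).
    rewrite qE rmorph_prod -mult_prod; last by move=> z; memC HC.
    congr p; apply: eq_bigr => z _.
    by rewrite rmorphB /= horner_algX horner_algC.
  rewrite (big_rem k kr)/= qy => pq.
  have h1 : p (y - k%:A) * m ^+ n <= p (y ^+ n.+1 - (k ^+ n.+1)%:A).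
    rewrite pq ler_wpM2l ?(sn_ge0 Hp)//; first by memC HC.
    have -> : m ^+ n = \prod_(z <- rem k r) m.
      by rewrite big_const_seq count_predT size_rem// sr iter_mulr_1.
    rewrite big_seq [leRHS]big_seq; apply: ler_prod => z _.
    by rewrite m_le ltW.
  have h2 : p (y ^+ n.+1 - (k ^+ n.+1)%:A) <= m ^+ n.+1 + (m / 2) ^+ n.+1.
    apply: le_trans (snB HC Hp _ _) _; [by memC HC|by memC HC|].
    rewrite (snA HC Hp) cabsX km lerD2r -pym.
    exact: (snX HC Hp).
  have mn0 : 0 < m ^+ n by exact: exprn_gt0.
  rewrite -(ler_pM2r mn0); apply: (le_trans h1); apply: (le_trans h2).
  rewrite mulrDl [m / 2]mulrC div1r exprMn !exprS le_eqVlt.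
  by apply/orP; left; apply/eqP; ring.
rewrite leNgt; apply/negP => lt_m.
have [|||n hn] := @exists_expr_lt R (1 / 2) ((p (y - k%:A) - m) / m).
- lra.
- lra.
- by rewrite divr_gt0// subr_gt0.
move: hn; rewrite ltr_pdivlMr// => hn; have := bound n.
have : m * (1 / 2) ^+ n.+1 <= (1 / 2) ^+ n * m.
  rewrite exprS; set t := _ ^+ n.
  have : 0 <= m * t by rewrite mulr_ge0 ?(ltW m0)// exprn_ge0//; lra.
  lra.
lra.
Qed.

(** The Gelfand-Mazur theorem: a positive distance to the scalars would be
    attained at scalars arbitrarily far away. *)
Lemma scalar_mod_exists x : C x -> exists l : R[i], p (x - l%:A) = 0.
Proof.
move=> Cx; have Cxl l : C (x - l%:A) by memC HC.
have [] := @complex_min_attained _ (fun l => p (x - l%:A)) (p x).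
- move=> z w /=; rewrite (_ : x - z%:A = (x - w%:A) - (z - w)%:A).
    by rewrite -(snA HC Hp); apply: (snB HC Hp); memC HC.
  by rewrite scalerBl opprB addrA subrK.
- move=> z; rewrite -(snA HC Hp) [in leLHS](_ : z%:A = x - (x - z%:A)).
    by rewrite [leRHS]addrC; apply: (snB HC Hp).
  by rewrite opprB addrC subrK.
move=> l /=; set m := p (x - l%:A) => m_le; exists l; rewrite -/m.
have m_ge0 : 0 <= m by exact: (sn_ge0 Hp).
apply/eqP; rewrite eq_le m_ge0 andbT leNgt; apply/negP => m0.
pose k : R[i] := ((m / 2)%:C)%C.
have kE : cabs k = m / 2 by rewrite cabsR ger0_norm// divr_ge0.
have far j : p (x - (l + k *+ j)%:A) = m.
  elim: j => [|j IH]; first by rewrite mulr0n addr0.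
  have := @scalar_distance_step (x - (l + k *+ j)%:A) k m (Cxl _) m0 IH.
  rewrite -addrA -opprD -scalerDl -addrA -mulrSr; apply=> // z.
  by rewrite -addrA -opprD -scalerDl.
(* Two points at distance [m] from [x] are at most [2 m] apart. *)
have := @snB _ _ _ _ HC _ Hp (x - l%:A) (x - (l + k *+ 5)%:A) (Cxl _) (Cxl _).
rewrite far -/m scalerDl opprB addrC addrA subrK addrAC subrr add0r (snA HC Hp).
rewrite -mulr_natr cabsM kE.
rewrite (_ : cabs 5%:R = 5); last by rewrite -(rmorph_nat (real_complex R)) cabsR normr_nat.
lra.
Qed.
End Multiplicative.

Definition scalar_mod p x : R[i] := xget 0 [set l | p (x - l%:A) = 0].

Section ScalarMod.
Variable p : U -> R.
Hypotheses (Hp : cstar_seminorm star C p)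
  (pM : forall x y, C x -> C y -> p (x * y) = p x * p y).

Lemma scalar_modP x : C x -> p (x - (scalar_mod p x)%:A) = 0.
Proof.
move=> Cx; have [l pl] := scalar_mod_exists Hp pM Cx.
by apply: (@xgetPex _ 0 [set l | p (x - l%:A) = 0]); exists l.
Qed.

Lemma scalar_mod_eq x (l : R[i]) : C x -> p (x - l%:A) = 0 -> scalar_mod p x = l.
Proof.
move=> Cx pl; apply/eqP; rewrite -subr_eq0; apply/eqP/cabs_eq0.
apply/eqP; rewrite eq_le cabs_ge0 andbT.
rewrite -(snA HC Hp) (_ : _%:A = (x - l%:A) - (x - (scalar_mod p x)%:A)).
  apply: (le_trans (snB HC Hp _ _)); [by memC HC|by memC HC|].
  by rewrite pl scalar_modP// addr0.
by rewrite scalerBl opprB [RHS]addrC addrA subrK.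
Qed.

Lemma scalar_mod_cabs x : C x -> cabs (scalar_mod p x) = p x.
Proof.
move=> Cx; have e0 := scalar_modP Cx.
have Ce : C (x - (scalar_mod p x)%:A) by memC HC.
have CA k : C k%:A by memC HC.
apply/eqP; rewrite eq_le -(snA HC Hp); apply/andP; split.
  have := snB HC Hp Cx Ce; rewrite e0 addr0; apply: le_trans.
  by rewrite opprB addrC subrK.
by have := snD Hp Ce (CA (scalar_mod p x)); rewrite e0 add0r subrK.
Qed.

Lemma scalar_mod_character N :
  (forall x, C x -> p x <= N x) -> character N (scalar_mod p).
Proof.
move=> pN; have Ce x : C x -> C (x - (scalar_mod p x)%:A) by move=> Cx; memC HC.
have p_le0 x : C x -> p x <= 0 -> p x = 0.
  by move=> Cx px; apply/eqP; rewrite eq_le px (sn_ge0 Hp).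
split.
- move=> x y Cx Cy; apply: scalar_mod_eq; first by memC HC.
  rewrite scalerDl opprD addrACA; apply: p_le0; first by memC HC.
  apply: (le_trans (snD Hp (Ce x Cx) (Ce y Cy))).
  by rewrite !scalar_modP// addr0.
- move=> k x Cx; apply: scalar_mod_eq; first by memC HC.
  by rewrite -scalerA -scalerBr (snZ Hp) ?scalar_modP ?mulr0//; exact: Ce.
- move=> x y Cx Cy; apply: scalar_mod_eq; first by memC HC.
  have -> : x * y - (scalar_mod p x * scalar_mod p y)%:A =
      (x - (scalar_mod p x)%:A) * y + scalar_mod p x *: (y - (scalar_mod p y)%:A).
    by rewrite mulrBl mulr_algl scalerBr scalerA addrA subrK.
  apply: p_le0; first by memC HC.
  apply: (le_trans (snD Hp _ _)); [by memC HC|by memC HC|].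
  rewrite pM//; last by memC HC.
  rewrite (snZ Hp); last by memC HC.
  by rewrite !scalar_modP// mul0r mulr0 addr0.
- apply: scalar_mod_eq; first by memC HC.
  by rewrite scale1r subrr (sn0 HC Hp).
- move=> x Cx; apply: scalar_mod_eq; first by memC HC.
  by rewrite -(starA Hs) -(starB Hs) (sn_starE Hs HC Hp) ?scalar_modP//; exact: Ce.
- by move=> x Cx; rewrite scalar_mod_cabs// pN.
Qed.
End ScalarMod.

Section Attained.
Variable N : U -> R.
Hypothesis HN : cstar_seminorm star C N.

Lemma selfadjoint_character_attains b : C b -> star b = b -> 0 < N b ->
  exists2 chi, character N chi & cabs (chi b) = N b.
Proof.
move=> Cb bb Nb.
have [p [[Hp pN pb] pM]] := multiplicative_attaining_exists Hs HC commC HN Cb bb Nb.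
exists (scalar_mod p); first exact: scalar_mod_character.
by rewrite scalar_mod_cabs// -[in LHS](mul1r b) pb ?(sn1 Hp) ?mul1r//; memC HC.
Qed.

(** The selfadjoint case is applied to [star b * b]. *)
Lemma character_attains b : C b ->
  exists2 chi, character N chi & cabs (chi b) = N b.
Proof.
move=> Cb; have Csb : C (star b) by memC HC.
have Nb0 := sn_ge0 HN Cb.
have [Nb|Nb] := eqVneq (N b) 0.
  have [||chi Hchi _] := @selfadjoint_character_attains 1 (sub1 HC).
  - exact: star1.
  - by rewrite (sn1 HN).
  exists chi => //; apply/eqP; rewrite Nb eq_le cabs_ge0 andbT -Nb.
  exact: (ch_le Hchi).
have [|||chi Hchi] := @selfadjoint_character_attains (star b * b).
- by memC HC.
- by rewrite (starM Hs) (starK Hs).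
- by rewrite (sn_star Hs HC HN)// exprn_gt0// lt_neqAle eq_sym Nb.
rewrite (sn_star Hs HC HN)// (chM Hchi)// (ch_star Hchi)// cabsM cabs_conj -expr2.
by exists chi => //; apply: eq_sqr_ge0 => //; exact: cabs_ge0.
Qed.

Section OneCharacter.
Variable chi : U -> R[i].
Hypothesis Hchi : character N chi.

Lemma chA k : chi k%:A = k.
Proof. by rewrite (chZ Hchi) ?(ch1 Hchi) ?mulr1//; memC HC. Qed.

Lemma chN x : C x -> chi (- x) = - chi x.
Proof. by move=> Cx; rewrite -scaleN1r (chZ Hchi)// mulN1r. Qed.

Lemma chB x y : C x -> C y -> chi (x - y) = chi x - chi y.
Proof. by move=> Cx Cy; rewrite (chD Hchi) ?chN//; memC HC. Qed.

Lemma chX x n : C x -> chi (x ^+ n) = chi x ^+ n.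
Proof.
move=> Cx; elim: n => [|n IH]; first by rewrite !expr0 (ch1 Hchi).
by rewrite !exprS (chM Hchi) ?IH//; memC HC.
Qed.
End OneCharacter.

Lemma sn_le_characters b (k : R) : C b ->
  (forall chi, character N chi -> cabs (chi b) <= k) -> N b <= k.
Proof. by move=> Cb bk; have [chi /bk + <-] := character_attains Cb. Qed.

End Attained.
End Characters.

(** * Positive elements *)

Section Positivity.
Variables (R : realType) (U : algType R[i]) (star : U -> U) (N : U -> R).
Hypotheses (Hs : is_star star) (HN : cstar_seminorm star setT N).
Implicit Types (x y h l : U) (C T : set U) (t : R).

Lemma polarization x y :
  (x + y) * (x + y) - (x - y) * (x - y) = (x * y + y * x) + (x * y + y * x).
Proof.
apply/eqP; rewrite subr_eq; apply/eqP.
rewrite mulrBl !mulrBr mulrDl !mulrDr opprB [in RHS]addrACA.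
have e (a b c : U) : a + b + (c - a) = b + c by rewrite addrC addrA subrK addrC.
by rewrite e [x * y + y * x]addrC e addrACA [y * x + x * x]addrC.
Qed.

Lemma star_subalgebraT : star_subalgebra star (@setT U).
Proof. by []. Qed.

Lemma cstar_seminorm_sub C : cstar_seminorm star C N.
Proof.
split.
- by move=> x _; exact: (sn_ge0 HN).
- by move=> x y _ _; exact: (snD HN).
- by move=> k x _; exact: (snZ HN).
- by move=> x y _ _; exact: (snM HN).
- exact: (sn1 HN).
- by move=> x _; exact: (sn_star_ge HN).
Qed.

(** A set of commuting selfadjoint elements lies in its bicommutant, a commutative
    star-subalgebra on which to evaluate characters. *)
Definition bicommutant T : set U :=
  [set x | forall y, (forall u, T u -> y * u = u * y) -> x * y = y * x].

Lemma bicommutant_sub T x : T x -> bicommutant T x.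
Proof. by move=> Tx y /(_ x Tx). Qed.

Lemma bicommutant_commutative T :
  (forall x y, T x -> T y -> x * y = y * x) -> commutative_set (bicommutant T).
Proof.
move=> TC x y Bx By; apply: Bx => u Tu; apply: By => v Tv.
exact: TC.
Qed.

Lemma bicommutant_star_subalgebra T : (forall x, T x -> star x = x) ->
  star_subalgebra star (bicommutant T).
Proof.
move=> Tsa; split.
- by move=> y _; rewrite mul1r mulr1.
- by move=> x y Bx By z Tz; rewrite mulrDl mulrDr Bx// By.
- by move=> k x Bx z Tz; rewrite -scalerAl -scalerAr Bx.
- by move=> x y Bx By z Tz; rewrite -mulrA By// mulrA Bx// mulrA.
- move=> x Bx z Tz; apply: (can_inj (starK Hs)).
  rewrite !(starM Hs) (starK Hs) -Bx// => u Tu.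
  by apply: (can_inj (starK Hs)); rewrite !(starM Hs) (starK Hs) (Tsa u)// Tz.
Qed.

(** Positivity read off the norm, which makes stability under addition
    immediate. *)
Definition pos h := star h = h /\ exists t, N (t%:C%C%:A - h) <= t.

Section PositivityOnCharacters.
Variable C : set U.
Hypotheses (HC : star_subalgebra star C) (commC : commutative_set C).

Lemma selfadjoint_character_real chi h : character star C N chi -> C h ->
  star h = h -> exists s : R, chi h = s%:C%C.
Proof.
move=> Hchi Ch hh; have := ch_star Hchi Ch; rewrite hh => chi_real.
exists (complex.Re (chi h)); rewrite RRe_real//.
by apply/CrealP; rewrite -chi_real.
Qed.

Lemma pos_character chi h : character star C N chi -> C h -> pos h -> 0 <= chi h.
Proof.
move=> Hchi Ch [hh [t Nt]].
have [s hs] := selfadjoint_character_real Hchi Ch hh.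
have := ch_le Hchi (_ : C (t%:C%C%:A - h)).
rewrite (chB HC Hchi) ?(chA HC Hchi)//; last by memC HC.
rewrite hs -rmorphB /= cabsR ler0c => le_t.
have : `|t - s| <= t by apply: le_trans Nt; apply: le_t; memC HC.
by rewrite ler_norml => /andP[_]; lra.
Qed.

Lemma character_pos h : C h -> star h = h ->
  (forall chi, character star C N chi -> 0 <= chi h) -> pos h.
Proof.
move=> Ch hh ch_ge0; split=> //; exists (N h).
apply: (sn_le_characters Hs HC commC (cstar_seminorm_sub C)); first by memC HC.
move=> chi Hchi; have [s hs] := selfadjoint_character_real Hchi Ch hh.
rewrite (chB HC Hchi) ?(chA HC Hchi)//; last by memC HC.
have := ch_ge0 chi Hchi; have := ch_le Hchi Ch.
rewrite hs -rmorphB /= !cabsR ler0c => sN s0.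
by rewrite ger0_norm// in sN; rewrite ger0_norm; lra.
Qed.
End PositivityOnCharacters.

Lemma posD h l : pos h -> pos l -> pos (h + l).
Proof.
move=> [hh [t ht]] [ll [r lr]]; split; first by rewrite (starD Hs) hh ll.
exists (t + r); rewrite rmorphD /= scalerDl opprD addrACA.
by apply: (le_trans (snD HN _ _)) => //; exact: lerD.
Qed.

Lemma star_real t : star t%:C%C%:A = t%:C%C%:A.
Proof. by rewrite (starA Hs) conj_real_complex. Qed.

Lemma pos_norm_sub h t : star h = h -> N h <= t -> pos (t%:C%C%:A - h).
Proof.
move=> hh ht; split; first by rewrite (starB Hs) star_real hh.
by exists t; rewrite opprB addrC subrK.
Qed.

Lemma bicommutant1_commutative h : commutative_set (bicommutant [set h]).
Proof. by apply: bicommutant_commutative => x y -> ->. Qed.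

Lemma bicommutant1_star_subalgebra h : star h = h ->
  star_subalgebra star (bicommutant [set h]).
Proof. by move=> hh; apply: bicommutant_star_subalgebra => x ->. Qed.

Lemma pos_sqr h : star h = h -> pos (h * h).
Proof.
move=> hh; have HC := bicommutant1_star_subalgebra hh.
have Ch : bicommutant [set h] h by exact: bicommutant_sub.
apply: (character_pos HC); [exact: bicommutant1_commutative|by memC HC| |].
  by rewrite (starM Hs) hh.
move=> chi Hchi; have [s hs] := selfadjoint_character_real Hchi Ch hh.
by rewrite (chM Hchi)// hs -rmorphM /= ler0c -expr2 sqr_ge0.
Qed.

Lemma pos_conj l h : star l = l -> pos h -> l * h = h * l -> pos (l * h * l).
Proof.
move=> ll ph lh; have hh := proj1 ph.
pose T := [set x | x = l \/ x = h].
have HC : star_subalgebra star (bicommutant T).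
  by apply: bicommutant_star_subalgebra => x [->|->].
have CC : commutative_set (bicommutant T).
  by apply: bicommutant_commutative => x y [->|->] [->|->].
have Cl : bicommutant T l by apply: bicommutant_sub; left.
have Ch : bicommutant T h by apply: bicommutant_sub; right.
apply: (character_pos HC CC); [by memC HC|by rewrite !(starM Hs) ll hh mulrA|].
move=> chi Hchi; have [s ls] := selfadjoint_character_real Hchi Cl ll.
rewrite !(chM Hchi)//; last by memC HC.
rewrite mulrAC ls -rmorphM /= -expr2 mulr_ge0//; first by rewrite ler0c sqr_ge0.
exact: (pos_character HC Hchi Ch ph).
Qed.

(** With [t = N (h + l)], [t - h = (t - (h + l)) + l] is positive, so that
    [0 <= chi h <= t] for every character. *)
Lemma norm_le_add_pos h l : pos h -> pos l -> N h <= N (h + l).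
Proof.
move=> ph pl; have hh := proj1 ph.
have HC := bicommutant1_star_subalgebra hh.
have Ch : bicommutant [set h] h by exact: bicommutant_sub.
set t := N (h + l).
have pth : pos (t%:C%C%:A - h).
  rewrite (_ : _ - h = (t%:C%C%:A - (h + l)) + l); last by rewrite opprD addrA subrK.
  apply: posD => //; apply: pos_norm_sub => //.
  by rewrite (starD Hs) hh (proj1 pl).
apply: (sn_le_characters Hs HC (@bicommutant1_commutative h) (cstar_seminorm_sub _)) => //.
move=> chi Hchi; have [s hs] := selfadjoint_character_real Hchi Ch hh.
have := pos_character HC Hchi Ch ph.
have := pos_character HC Hchi _ pth.
rewrite (chB HC Hchi) ?(chA HC Hchi)//; last by memC HC.
rewrite hs -rmorphB /= !ler0c cabsR => h1 h2.
have {h1} := h1 _; rewrite ger0_norm// => h1.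
by rewrite -subr_ge0 h1//; memC HC.
Qed.

(** If [star x * x] took a negative value, cutting [x] down by [y] would make
    [c = - star z * z] almost positive with [N c = tau] its largest value. Then
    [P = z * star z], being [c] plus squares, is almost positive too and
    reaches [tau], so that [P * P + tau P] reaches [2 tau^2]; but it equals
    [z * (tau - c) * star z], of norm at most [3/2 tau^2] as [c >= - tau/2]. *)
Theorem pos_star_mul x : pos (star x * x).
Proof.
have [h hE] : exists h, h = star x * x by exists (star x * x).
rewrite -hE; have hh : star h = h by rewrite hE (starM Hs) (starK Hs).
have HC := bicommutant1_star_subalgebra hh; have CC := @bicommutant1_commutative h.
have HNC := cstar_seminorm_sub (bicommutant [set h]).
set C := bicommutant [set h] in HC CC HNC.
have Ch : C h by exact: bicommutant_sub.
apply: (character_pos HC CC Ch hh) => chi Hchi.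
have [s0 hs0] := selfadjoint_character_real Hchi Ch hh.
rewrite hs0 ler0c leNgt; apply/negP => s0_lt0.
pose t := N h.
have Cg : C (t%:C%C%:A - h) by memC HC.
have [chi1 Hchi1 chi1g] := character_attains Hs HC CC HNC Cg.
have [s1 hs1] := selfadjoint_character_real Hchi1 Ch hh.
have ch_range f s : character star C N f -> f h = s%:C%C -> s1 <= s <= t.
  move=> Hf fs; have := ch_le Hf Ch; rewrite fs cabsR ler_norml => /andP[h1 h2].
  rewrite h2 andbT.
  have := ch_le Hf Cg; rewrite -chi1g.
  rewrite (chB HC Hf) ?(chB HC Hchi1) ?(chA HC Hf) ?(chA HC Hchi1); try by memC HC.
  rewrite fs hs1 -!rmorphB /= !cabsR.
  have := ch_le Hchi1 Ch; rewrite hs1 cabsR ler_norml => /andP[h3 h4].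
  by rewrite !ger0_norm ?subr_ge0//; lra.
have /andP[s10 _] := ch_range _ _ Hchi hs0.
(* [- tau] is the least value of [h] on the characters. *)
pose tau := - s1; have tau0 : 0 < tau by rewrite /tau; lra.
have t_ge : tau <= t.
  by have := ch_le Hchi1 Ch; rewrite hs1 cabsR ler_norml => /andP[+ _]; rewrite -/t /tau; lra.
have t0 : 0 < t by lra.
have [|||n hn] := @exists_expr_lt R (t / (t + tau)) ((tau / 2) / t).
- by apply: divr_ge0; lra.
- by rewrite ltr_pdivrMr; lra.
- by rewrite !divr_gt0.
move: hn; rewrite ltr_pdivlMr// => hn.
(* [y] is [1] where [h] equals [- tau] and small where [h >= 0]. *)
pose g := ((t + tau)^-1)%:C%C *: (t%:C%C%:A - h).
pose y := g ^+ n.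
have Cy : C y by rewrite /y /g; memC HC.
have yy : star y = y.
  by rewrite /y (starX Hs) /g (starZ Hs) conj_real_complex (starB Hs) star_real hh.
pose z := x * y; pose c := - (star z * z).
have cE : c = - (h * y * y).
  rewrite /c /z (starM Hs) yy -[in LHS]mulrA (mulrA (star x)) -hE mulrA.
  by rewrite (CC y h).
have Cc : C c by rewrite cE; memC HC.
have cc : star c = c by rewrite /c (starN Hs) (starM Hs) (starK Hs).
have ch_c f s : character star C N f -> f h = s%:C%C ->
    f c = (- (s * (((t - s) / (t + tau)) ^+ n) ^+ 2))%:C%C.
  move=> Hf fs; rewrite cE (chN Hf); last by memC HC.
  rewrite !(chM Hf)//; last by memC HC.
  rewrite fs /y (chX HC Hf); last by rewrite /g; memC HC.
  rewrite /g (chZ Hf)// (chB HC Hf) ?(chA HC Hf)//; last by memC HC.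
  rewrite fs -rmorphB -rmorphM /= -rmorphXn /= -!rmorphM -rmorphN /=.
  by rewrite -mulrA -expr2 [_^-1 * _]mulrC.
have c_range f : character star C N f ->
    exists2 v : R, f c = v%:C%C & - (tau / 2) <= v <= tau.
  move=> Hf; have [s fs] := selfadjoint_character_real Hf Ch hh.
  have /andP[s1s st] := ch_range _ _ Hf fs.
  rewrite (ch_c f s Hf fs); eexists; first by [].
  have tt0 : 0 < t + tau by lra.
  set w := (t - s) / (t + tau).
  have w0 : 0 <= w by rewrite divr_ge0//; lra.
  have w1 : w <= 1 by rewrite ler_pdivrMr// /tau; lra.
  have W0 : 0 <= w ^+ n by rewrite exprn_ge0.
  have W1 : w ^+ n <= 1 by rewrite exprn_ile1.
  have [s_ge0|s_lt0] := lerP 0 s.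
    have Wq : w ^+ n <= (t / (t + tau)) ^+ n.
      apply: lerXn2r; rewrite ?nnegrE//; first by rewrite divr_ge0// ltW.
      by rewrite ler_pM2r ?invr_gt0//; lra.
    have : s * (w ^+ n) ^+ 2 <= (t / (t + tau)) ^+ n * t.
      move: W0 W1 Wq; set W := w ^+ n; set Q := _ ^+ n => W0 W1 Wq.
      have : 0 <= (t - s) * W by rewrite mulr_ge0// subr_ge0.
      have : 0 <= s * (W * (1 - W)) by rewrite !mulr_ge0// subr_ge0.
      have : 0 <= t * (Q - W) by rewrite mulr_ge0 ?(ltW t0)// subr_ge0.
      lra.
    have : 0 <= s * (w ^+ n) ^+ 2 by rewrite mulr_ge0// sqr_ge0.
    by move=> ? ?; apply/andP; split; lra.
  have -> : - (s * (w ^+ n) ^+ 2) = - s * (w ^+ n) ^+ 2 by rewrite mulNr.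
  have : - s <= tau by rewrite /tau; lra.
  have : 0 <= (w ^+ n) ^+ 2 <= 1 by rewrite sqr_ge0 expr_le1.
  by move=> /andP[? ?] ?; apply/andP; split; nra.
have Nc : N c = tau.
  apply/eqP; rewrite eq_le; apply/andP; split.
    apply: (sn_le_characters Hs HC CC HNC Cc) => f /c_range[v -> /andP[v1 v2]].
    by rewrite cabsR ler_norml; apply/andP; split; lra.
  have := ch_le Hchi1 Cc; rewrite (ch_c _ _ Hchi1 hs1) cabsR.
  rewrite (_ : t - s1 = t + tau)// divff ?gt_eqF//; last by lra.
  by rewrite !expr1n mulr1 -/tau gtr0_norm.
have [P PE] : exists P, P = z * star z by exists (z * star z).
have PP : star P = P by rewrite PE (starM Hs) (starK Hs).
have NP : N P = tau.
  rewrite -Nc PE -{1}(starK Hs z) (sn_star Hs star_subalgebraT HN)//.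
  rewrite (sn_starE Hs star_subalgebraT HN)//.
  by rewrite -(sn_star Hs star_subalgebraT HN)// /c (snN HN).
have pos_c : pos (c + (tau / 2)%:C%C%:A).
  apply: (character_pos HC CC); first by memC HC.
    by rewrite (starD Hs) cc star_real.
  move=> f Hf; rewrite (chD Hf) ?(chA HC Hf)//; last by memC HC.
  have [v -> /andP[v1 _]] := c_range f Hf.
  by rewrite -rmorphD /= ler0c; lra.
pose u := z + star z; pose v := 'i *: (z - star z).
have pos_P : pos (P + P + tau%:C%C%:A).
  have -> : P + P + tau%:C%C%:A =
      u * u + v * v + (c + (tau / 2)%:C%C%:A) + (c + (tau / 2)%:C%C%:A).
    rewrite /u /v -scalerAl -scalerAr scalerA -['i * 'i]expr2 sqrCi scaleN1r.
    rewrite (polarization z (star z)) -PE -[in RHS]addrA.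
    rewrite (addrACA c) -scalerDl -rmorphD /= -splitr addrA; congr (_ + _).
    by rewrite addrACA /c !addrK.
  apply: posD => //; apply: posD => //; apply: posD; apply: pos_sqr.
    by rewrite /u (starD Hs) (starK Hs) addrC.
  by rewrite /v (starZ Hs) conjCi (starB Hs) (starK Hs) scaleNr -scalerN opprB.
have HCP := bicommutant1_star_subalgebra PP.
have CCP := @bicommutant1_commutative P.
have CP : bicommutant [set P] P by exact: bicommutant_sub.
have [f Hf] := character_attains Hs HCP CCP (cstar_seminorm_sub _) CP.
have [a fP] := selfadjoint_character_real Hf CP PP.
rewrite NP fP cabsR => a_tau.
have aE : a = tau.
  have := pos_character HCP Hf (_ : bicommutant [set P] (P + P + tau%:C%C%:A)) pos_P.
  rewrite !(chD Hf) ?(chA HCP Hf) ?fP; try by memC HCP.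
  rewrite -!rmorphD /= ler0c => /(_ _)/wrap[|]; first by memC HCP.
  move=> a_ge; have [a0|a0] := lerP 0 a.
    by rewrite (ger0_norm a0) in a_tau.
  by rewrite (ltr0_norm a0) in a_tau; lra.
have N1 : 2 * tau ^+ 2 <= N (P * P + tau%:C%C *: P).
  have := ch_le Hf (_ : bicommutant [set P] (P * P + tau%:C%C *: P)).
  rewrite (chD Hf) ?(chM Hf) ?(chZ Hf) ?fP; try by memC HCP.
  rewrite -!rmorphM -rmorphD /= cabsR aE => /(_ _)/wrap[|]; first by memC HCP.
  by rewrite ger0_norm; nra.
have : N (P * P + tau%:C%C *: P) <= tau * (3 / 2 * tau).
  have -> : P * P + tau%:C%C *: P = z * (tau%:C%C%:A - c) * star z.
    rewrite PE /c opprK mulrDr mulrDl !mulrA addrC -scalerAr mulr1 -scalerAl.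
    by [].
  have -> : tau * (3 / 2 * tau) = N z * (3 / 2 * tau) * N (star z).
    rewrite (sn_starE Hs star_subalgebraT HN)// [in RHS]mulrAC -[N z * N z]expr2.
    by rewrite -(sn_star Hs star_subalgebraT HN)// -(snN HN)// -/c Nc.
  apply: (le_trans (snM HN _ _)) => //.
  apply: ler_wpM2r; first exact: (sn_ge0 HN).
  apply: (le_trans (snM HN _ _)) => //.
  apply: ler_wpM2l; first exact: (sn_ge0 HN).
  apply: (sn_le_characters Hs HC CC HNC); first by memC HC.
  move=> e He; rewrite (chB HC He) ?(chA HC He)//; last by memC HC.
  have [r -> /andP[r1 r2]] := c_range e He.
  by rewrite -rmorphB /= cabsR ger0_norm; lra.
nra.
Qed.
End Positivity.

(** * Functions of an element through characters *)

Section FunctionalCalculus.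
Variables (R : realType) (U : algType R[i]) (star : U -> U) (N : U -> R) (C : set U).
Hypotheses (Hs : is_star star) (HC : star_subalgebra star C).
Hypotheses (commC : commutative_set C) (HN : cstar_seminorm star C N).
Hypothesis N_eq0 : forall x, C x -> N x = 0 -> x = 0.
Hypothesis C_complete : forall u : nat -> U, (forall n, C (u n)) ->
  (forall n m, N (u n - u m) <= n.+1%:R^-1 + m.+1%:R^-1) ->
  exists2 l, C l & forall n, N (u n - l) <= n.+1%:R^-1.
Variable F : U.
Hypothesis CF : C F.
Implicit Types (phi psi f : R[i] -> R[i]) (r : R[i] -> R) (x y : U) (z w : R[i]).

Local Notation character := (character star C N).

Definition character_values : set R[i] := [set z | exists2 chi, character chi & chi F = z].
Local Notation V := character_values.

(** [x] is [phi (F)]: their Gelfand transforms agree. *)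
Definition calculus_value phi x := C x /\ forall chi, character chi -> chi x = phi (chi F).
Definition in_calculus phi := exists x, calculus_value phi x.

Lemma characters_separate x y : C x -> C y ->
  (forall chi, character chi -> chi x = chi y) -> x = y.
Proof.
move=> Cx Cy xy; apply/eqP; rewrite -subr_eq0; apply/eqP/N_eq0; first by memC HC.
apply/eqP; rewrite eq_le (sn_ge0 HN) ?andbT; last by memC HC.
apply: (sn_le_characters Hs HC commC HN); first by memC HC.
by move=> chi Hchi; rewrite (chB HC Hchi)// xy// subrr cabs0.
Qed.

Lemma calculus_value_inj phi psi x y : calculus_value phi x -> calculus_value psi y ->
  (forall z, V z -> phi z = psi z) -> x = y.
Proof.
move=> [Cx xphi] [Cy ypsi] e; apply: characters_separate => // chi Hchi.
by rewrite xphi// ypsi// e//; exists chi.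
Qed.

Lemma calculus_value_id : calculus_value id F.
Proof. by []. Qed.

Lemma calculus_value_cst (k : R[i]) : calculus_value (fun=> k) k%:A.
Proof. by split=> [|chi Hchi]; [memC HC|rewrite (chA HC Hchi)]. Qed.

Lemma calculus_valueD phi psi x y : calculus_value phi x -> calculus_value psi y ->
  calculus_value (fun z => phi z + psi z) (x + y).
Proof.
move=> [Cx xphi] [Cy ypsi]; split=> [|chi Hchi]; first by memC HC.
by rewrite (chD Hchi)// xphi// ypsi.
Qed.

Lemma calculus_valueM phi psi x y : calculus_value phi x -> calculus_value psi y ->
  calculus_value (fun z => phi z * psi z) (x * y).
Proof.
move=> [Cx xphi] [Cy ypsi]; split=> [|chi Hchi]; first by memC HC.
by rewrite (chM Hchi)// xphi// ypsi.
Qed.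

Lemma calculus_valueZ (k : R[i]) phi x : calculus_value phi x ->
  calculus_value (fun z => k * phi z) (k *: x).
Proof.
move=> [Cx xphi]; split=> [|chi Hchi]; first by memC HC.
by rewrite (chZ Hchi)// xphi.
Qed.

Lemma calculus_value_star phi x : calculus_value phi x ->
  calculus_value (fun z => (phi z)^*) (star x).
Proof.
move=> [Cx xphi]; split=> [|chi Hchi]; first by memC HC.
by rewrite (ch_star Hchi)// xphi.
Qed.

Lemma in_calculus_cst (k : R[i]) : in_calculus (fun=> k).
Proof. by exists k%:A; exact: calculus_value_cst. Qed.

Lemma in_calculusD phi psi : in_calculus phi -> in_calculus psi ->
  in_calculus (fun z => phi z + psi z).
Proof. by move=> [x ?] [y ?]; exists (x + y); exact: calculus_valueD. Qed.

Lemma in_calculusM phi psi : in_calculus phi -> in_calculus psi ->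
  in_calculus (fun z => phi z * psi z).
Proof. by move=> [x ?] [y ?]; exists (x * y); exact: calculus_valueM. Qed.

Lemma in_calculus_conj phi : in_calculus phi -> in_calculus (fun z => (phi z)^*).
Proof. by move=> [x ?]; exists (star x); exact: calculus_value_star. Qed.

Lemma in_calculusX phi n : in_calculus phi -> in_calculus (fun z => phi z ^+ n).
Proof.
move=> phiE; elim: n => [|n IH].
  by under eq_fun do rewrite expr0; exact: in_calculus_cst.
by under eq_fun do rewrite exprS; exact: in_calculusM.
Qed.

Lemma in_calculus_sum (I : Type) (s : seq I) (phi : I -> R[i] -> R[i]) :
  (forall i, in_calculus (phi i)) -> in_calculus (fun z => \sum_(i <- s) phi i z).
Proof.
move=> phiE; elim: s => [|i s IH].
  by under eq_fun do rewrite big_nil; exact: in_calculus_cst.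
by under eq_fun do rewrite big_cons; exact: in_calculusD.
Qed.

Lemma in_calculus_eq phi psi : (forall z, V z -> phi z = psi z) ->
  in_calculus phi -> in_calculus psi.
Proof.
move=> e [x [Cx xphi]]; exists x; split=> // chi Hchi.
by rewrite xphi// e//; exists chi.
Qed.

Lemma in_calculus_limit phi :
  (forall e : R, 0 < e -> exists2 psi, in_calculus psi &
    forall z, V z -> cabs (phi z - psi z) <= e) -> in_calculus phi.
Proof.
move=> approx.
have /choice[psi psiP] n : exists psi_, in_calculus psi_ /\
    forall z, V z -> cabs (phi z - psi_ z) <= n.+1%:R^-1.
  by have [|psi_ ? ?] := approx n.+1%:R^-1; [rewrite invr_gt0|exists psi_].
have /choice[u uP] n : exists x, calculus_value (psi n) x by have [] := psiP n.
have Cu n : C (u n) by have [] := uP n.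
have chi_u chi n : character chi -> cabs (phi (chi F) - chi (u n)) <= n.+1%:R^-1.
  move=> Hchi; have [_ ->//] := uP n; have [_ h] := psiP n.
  by apply: h; exists chi.
have [|l Cl ul] := C_complete Cu.
  move=> n m; apply: (sn_le_characters Hs HC commC HN); first by apply: (subB HC).
  move=> chi Hchi; rewrite (chB HC Hchi)//.
  have := lerD (chi_u chi n Hchi) (chi_u chi m Hchi); apply: le_trans.
  rewrite -[X in X - _](subrK (phi (chi F))) -addrA [leRHS]addrC.
  by rewrite addrC (cabsB (phi _) (chi (u n))); exact: cabsD.
exists l; split=> // chi Hchi; apply/eqP; rewrite -subr_eq0; apply/eqP/cabs_eq0.
apply/eqP; rewrite eq_le cabs_ge0 andbT; apply/ler_addgt0Pl => e e0; rewrite addr0.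
have [|n] := @ltr_add_invr _ 0 (e / 2); first by rewrite divr_gt0.
rewrite add0r => hn.
have h1 := chi_u chi n Hchi.
have h2 : cabs (chi (u n) - chi l) <= n.+1%:R^-1.
  by apply: le_trans (ul n); rewrite -(chB HC Hchi)//; apply: (ch_le Hchi); memC HC.
have h3 := cabsD (phi (chi F) - chi (u n)) (chi (u n) - chi l).
rewrite addrA subrK in h3.
rewrite cabsB; move: hn h1 h2; set k := _^-1; lra.
Qed.

(** The geometric series of [1 - r / M], where [M] bounds [r], converges
    uniformly. *)
Lemma in_calculus_inv r (d : R) : 0 < d -> (forall z, V z -> d <= r z) ->
  in_calculus (fun z => (r z)%:C%C) -> in_calculus (fun z => ((r z)^-1)%:C%C).
Proof.
move=> d0 dr rE; have [x [Cx xr]] := rE.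
have Nx0 := sn_ge0 HN Cx.
pose M := N x + d; have M0 : 0 < M by rewrite /M; lra.
have rM z : V z -> r z <= M.
  move=> [chi Hchi chiF]; have := ch_le Hchi Cx; rewrite xr// chiF cabsR.
  by have := ler_norm (r z); rewrite /M; lra.
pose t z := 1 - r z / M; pose q := 1 - d / M.
have q0 : 0 <= q by rewrite subr_ge0 ler_pdivrMr// mul1r /M; lra.
have q1 : q < 1 by rewrite ltrBlDr ltrDl divr_gt0.
have t_range z : V z -> 0 <= t z <= q.
  move=> Vz; rewrite subr_ge0 ler_pdivrMr// mul1r rM//=.
  by rewrite lerD2l lerN2 ler_pM2r ?invr_gt0// dr.
have tE : in_calculus (fun z => (t z)%:C%C).
  have := in_calculusD (in_calculus_cst 1)
    (in_calculusM (in_calculus_cst (- M^-1)%:C%C) rE).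
  apply: in_calculus_eq => z _.
  by rewrite -rmorphM -[1](rmorph1 (real_complex R)) -rmorphD /= /t mulNr mulrC.
apply: in_calculus_limit => e e0.
have [|n hn] := exists_expr_lt q0 q1 (_ : 0 < e * d); first by rewrite mulr_gt0.
exists (fun z => (M^-1)%:C%C * \sum_(j < n) (t z)%:C%C ^+ j).
  apply: in_calculusM; first exact: in_calculus_cst.
  by apply: in_calculus_sum => j; exact: in_calculusX.
move=> z Vz; have /andP[t0 tq] := t_range z Vz; have rd := dr z Vz.
have r0 : 0 < r z by lra.
under eq_bigr do rewrite -rmorphXn /=.
rewrite -rmorph_sum -rmorphM -rmorphB /= cabsR.
have -> : (r z)^-1 - M^-1 * \sum_(j < n) t z ^+ j = t z ^+ n / r z.
  have rtE : r z = M * (1 - t z) by rewrite /t subKr mulrC divfK// gt_eqF.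
  have geom : (1 - t z) * \sum_(j < n) t z ^+ j = 1 - t z ^+ n.
    by have := subrX1 (t z) n; set S := bigop _ _ _; lra.
  have t1 : 1 - t z != 0.
    by apply/negP => /eqP t1; move: r0; rewrite rtE t1 mulr0 ltxx.
  apply: (mulfI t1); rewrite mulrBr [X in _ - X]mulrCA geom rtE.
  by field; rewrite t1 gt_eqF.
rewrite ger0_norm; last by apply: divr_ge0; [exact: exprn_ge0|exact: ltW].
rewrite ler_pdivrMr//.
have : t z ^+ n <= q ^+ n by apply: lerXn2r; rewrite ?nnegrE.
have : e * d <= e * r z by rewrite ler_pM2l.
lra.
Qed.

Definition unital_spectrum : set R[i] := [set l | ~ exists y,
  [/\ C y, (l%:A - F) * y = 1 & y * (l%:A - F) = 1]].

Lemma character_values_spec : V `<=` unital_spectrum.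
Proof.
move=> z [chi Hchi chiF] [y [Cy + _]] => /(congr1 chi).
rewrite (chM Hchi)//; last by memC HC.
rewrite (chB HC Hchi) ?(chA HC Hchi)//; last by memC HC.
by rewrite chiF subrr mul0r (ch1 Hchi) => /eqP; rewrite eq_sym oner_eq0.
Qed.

(** The inverse of [l - F] is the value at [F] of [(l - z)^* / |l - z|^2]. With
    [not_spec_gap] this makes the spectrum the closure of the set of the
    character values, whence its compactness. *)
Lemma not_spec_away (d : R) l : 0 < d -> (forall z, V z -> d <= cabs (l - z)) ->
  ~ unital_spectrum l.
Proof.
move=> d0 lV; apply.
have lE : in_calculus (fun z => l - z).
  have := in_calculusD (in_calculus_cst l)
    (in_calculusM (in_calculus_cst (- 1)) (ex_intro _ F calculus_value_id)).
  by under eq_fun do rewrite mulN1r.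
have invE : in_calculus (fun z => ((cabs (l - z) ^+ 2)^-1)%:C%C).
  apply: (@in_calculus_inv _ (d ^+ 2)); first by rewrite exprn_gt0.
    by move=> z Vz; rewrite ler_pXn2r ?nnegrE ?cabs_ge0 ?lV// ltW.
  under eq_fun do rewrite cabs_sqr; apply: in_calculusM => //.
  exact: in_calculus_conj.
have [y [Cy hy]] := in_calculusM (in_calculus_conj lE) invE.
have y_inv : (l%:A - F) * y = 1.
  apply: characters_separate; [by memC HC|by memC HC|] => chi Hchi.
  rewrite (chM Hchi)//; last by memC HC.
  rewrite (chB HC Hchi) ?(chA HC Hchi) ?(ch1 Hchi)//; last by memC HC.
  rewrite hy// mulrA -cabs_sqr -rmorphM /= divff ?rmorph1//.
  have := lV (chi F) (ex_intro2 _ _ chi Hchi erefl) => h.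
  by rewrite gt_eqF// exprn_gt0//; lra.
exists y; split=> //; rewrite (commC Cy) //; memC HC.
Qed.

Lemma not_spec_gap l : ~ unital_spectrum l ->
  exists2 d : R, 0 < d & forall z, V z -> d <= cabs (l - z).
Proof.
move=> /contrapT[y [Cy ly _]].
have Ny : 0 < N y.
  rewrite lt_neqAle eq_sym (sn_ge0 HN)// andbT; apply/negP => /eqP /(N_eq0 Cy) y0.
  by move: ly; rewrite y0 mulr0 => /esym/eqP; rewrite oner_eq0.
exists (N y)^-1; first by rewrite invr_gt0.
move=> z [chi Hchi <-]; have := congr1 chi ly.
rewrite (chM Hchi)//; last by memC HC.
rewrite (chB HC Hchi) ?(chA HC Hchi) ?(ch1 Hchi)//; last by memC HC.
move=> /(congr1 (@cabs R)); rewrite cabsM cabs1 => e.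
have := ch_le Hchi Cy; have := cabs_ge0 (l - chi F); have := cabs_ge0 (chi y).
by rewrite -[_^-1]mul1r ler_pdivrMr// -e; nra.
Qed.

Lemma spec_le l : unital_spectrum l -> cabs l <= N F.
Proof.
move=> sl; rewrite leNgt; apply/negP => lF.
apply: (@not_spec_away (cabs l - N F) l _ _ sl); first by rewrite subr_gt0.
move=> z [chi Hchi <-]; have := ch_le Hchi CF.
by have := cabsD (l - chi F) (chi F); rewrite subrK; lra.
Qed.

Lemma spec_compact : compact (unital_spectrum : set R[i]^o).
Proof.
apply: (@complex_compact _ _ (N F)); last exact: spec_le.
rewrite -[unital_spectrum]setCK; apply: open_closedC.
rewrite openE => l /not_spec_gap[d d0 ld]; apply/nbhs_complexP.
exists (d / 2); first by rewrite divr_gt0.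
move=> w wl; apply: (@not_spec_away (d / 2)); first by rewrite divr_gt0.
move=> z /ld; have := cabsD (l - w) (w - z).
by rewrite addrA subrK (cabsB l w); lra.
Qed.

Lemma spec_net (d : R) : 0 < d ->
  exists2 s : seq R[i], (forall w, w \in s -> unital_spectrum w) &
    forall z, unital_spectrum z -> exists2 w, w \in s & cabs (z - w) < d.
Proof. by move=> d0; exact: (compact_finite_net spec_compact). Qed.

Lemma bump_in_calculus (M : R) w n :
  in_calculus (fun z => ((1 - cabs (z - w) ^+ 2 / M) ^+ n)%:C%C).
Proof.
have wE : in_calculus (fun z => z - w).
  by apply: in_calculusD; [exists F|exact: in_calculus_cst].
have := in_calculusX n (in_calculusD (in_calculus_cst 1)
  (in_calculusM (in_calculus_cst (- M^-1)%:C%C)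
    (in_calculusM wE (in_calculus_conj wE)))).
apply: in_calculus_eq => z _; rewrite -cabs_sqr [in RHS]rmorphXn /=; congr (_ ^+ _).
by rewrite -rmorphM -[1](rmorph1 (real_complex R)) -rmorphD /= mulNr mulrC.
Qed.

(** Polynomial density: average the values of [f] on a finite net against the
    bumps [(1 - |z - w|^2 / M)^n], which concentrate near [w] as [n] grows and
    whose sum is bounded below, hence invertible in the calculus. *)
Theorem continuous_in_calculus f :
  {within (unital_spectrum : set R[i]^o), continuous (f : R[i]^o -> R[i]^o)} -> in_calculus f.
Proof.
move=> f_cont; apply: in_calculus_limit => e e0.
have e20 : 0 < e / 2 by rewrite divr_gt0.
have [d d0 fd] := compact_uniform_modulus spec_compact f_cont e20.
have d20 : 0 < d / 2 by rewrite divr_gt0.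
have [s s_spec s_net] := spec_net d20.
pose rho := N F; have rho0 : 0 <= rho by exact: (sn_ge0 HN).
(* [M] exceeds [|z - w|^2] on the spectrum, and [d^2]. *)
pose M := (2 * rho) ^+ 2 + d ^+ 2 + 1.
have M0 : 0 < M by have := sqr_ge0 (2 * rho); have := sqr_ge0 d; rewrite /M; lra.
pose k w z := 1 - cabs (z - w) ^+ 2 / M.
pose al := 1 - (d / 2) ^+ 2 / M; pose be := 1 - d ^+ 2 / M.
have be0 : 0 <= be.
  by rewrite subr_ge0 ler_pdivrMr// /M; have := sqr_ge0 (2 * rho); lra.
have be_al : be < al.
  by rewrite ltrD2l ltrN2 ltr_pM2r ?invr_gt0//; nra.
have al0 : 0 < al by lra.
have k_ge0 w z : unital_spectrum w -> unital_spectrum z -> 0 <= k w z.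
  move=> /spec_le wN /spec_le zN; rewrite subr_ge0 ler_pdivrMr// mul1r.
  have h := cabsD z (- w); rewrite cabsN in h; rewrite -/rho in wN zN.
  have := cabs_ge0 (z - w); have := sqr_ge0 d; rewrite /M; nra.
have k_near w z : cabs (z - w) < d / 2 -> al <= k w z.
  move=> zw; rewrite lerD2l lerN2 ler_pM2r ?invr_gt0//.
  have := cabs_ge0 (z - w); nra.
have k_far w z : d <= cabs (z - w) -> k w z <= be.
  by move=> zw; rewrite lerD2l lerN2 ler_pM2r ?invr_gt0//; nra.
pose S := \sum_(w <- s) cabs (f w) + e.
have f_le_sum w : w \in s -> cabs (f w) <= \sum_(w <- s) cabs (f w).
  move=> ws; rewrite (big_rem w ws) /= lerDl; apply: sumr_ge0 => i _; exact: cabs_ge0.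
have f_le z : unital_spectrum z -> cabs (f z) <= S.
  move=> sz; have [w ws zw] := s_net z sz.
  have := fd z w sz (s_spec w ws); have := f_le_sum w ws.
  have := cabsD (f z - f w) (f w); rewrite subrK /S => h1 h2 h3.
  by have {h3} := h3 _; lra.
have S0 : 0 < S by rewrite ltr_wpDl// sumr_ge0// => i _; exact: cabs_ge0.
pose m : R := (size s)%:R.
have m0 : 0 <= m by rewrite ler0n.
have [|||n hn] := @exists_expr_lt R (be / al) (e / 2 / (m * (2 * S) + 1)).
- by rewrite divr_ge0// ltW.
- by rewrite ltr_pdivrMr// mul1r.
- by rewrite divr_gt0//; nra.
have aln : 0 < al ^+ n by rewrite exprn_gt0.
have {hn} far_small : m * (2 * S) * be ^+ n <= e / 2 * al ^+ n.
  move: hn; rewrite expr_div_n ltr_pdivrMr// [_ / _ * _]mulrAC ltr_pdivlMr; last by nra.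
  have := exprn_ge0 n be0; lra.
pose D z := \sum_(w <- s) k w z ^+ n.
have D_ge z : unital_spectrum z -> al ^+ n <= D z.
  move=> sz; have [w ws zw] := s_net z sz; rewrite /D (big_rem w ws) /=.
  have := k_near w z zw => kw.
  have : al ^+ n <= k w z ^+ n by apply: lerXn2r; rewrite ?nnegrE//; lra.
  suff : 0 <= \sum_(y <- rem w s) k y z ^+ n by lra.
  rewrite big_seq; apply: sumr_ge0 => y /mem_rem ys.
  by rewrite exprn_ge0// k_ge0//; exact: s_spec.
have DE : in_calculus (fun z => (D z)%:C%C).
  under eq_fun do rewrite /D rmorph_sum; apply: in_calculus_sum => w.
  exact: bump_in_calculus.
exists (fun z => ((D z)^-1)%:C%C * \sum_(w <- s) f w * (k w z ^+ n)%:C%C).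
  apply: in_calculusM.
    by apply: in_calculus_inv DE; [exact: aln|move=> z /character_values_spec; exact: D_ge].
  apply: in_calculus_sum => w; apply: in_calculusM; first exact: in_calculus_cst.
  exact: bump_in_calculus.
move=> z /character_values_spec sz.
have Dal := D_ge z sz; have D0 : 0 < D z by lra.
have -> : f z - ((D z)^-1)%:C%C * \sum_(w <- s) f w * (k w z ^+ n)%:C%C =
    ((D z)^-1)%:C%C * \sum_(w <- s) (f z - f w) * (k w z ^+ n)%:C%C.
  under [in RHS]eq_bigr do rewrite mulrBl.
  rewrite sumrB mulrBr -mulr_sumr -rmorph_sum -/(D z) mulrCA -rmorphM /=.
  by rewrite mulVf ?gt_eqF// rmorph1 mulr1.
rewrite cabsM cabsR gtr0_norm ?invr_gt0// mulrC ler_pdivrMr//.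
apply: (le_trans (cabs_sum _ _ _)).
apply: (@le_trans _ _ (\sum_(w <- s) (e / 2 * k w z ^+ n + 2 * S * be ^+ n))).
  rewrite big_seq [leRHS]big_seq; apply: ler_sum => w ws.
  have kn0 : 0 <= k w z ^+ n by rewrite exprn_ge0// k_ge0//; exact: s_spec.
  have bn0 := exprn_ge0 n be0.
  rewrite cabsM cabsR ger0_norm//.
  have [far|near] := lerP d (cabs (z - w)).
    have kb : k w z ^+ n <= be ^+ n.
      by apply: lerXn2r; rewrite ?nnegrE ?k_ge0 ?k_far//; exact: s_spec.
    have h : cabs (f z - f w) <= 2 * S.
      have := cabsD (f z) (- f w); rewrite cabsN.
      by have := f_le z sz; have := f_le w (s_spec w ws); lra.
    have : cabs (f z - f w) * k w z ^+ n <= 2 * S * be ^+ n.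
      by apply: ler_pM => //; exact: cabs_ge0.
    have : 0 <= e / 2 * k w z ^+ n by rewrite mulr_ge0// ltW.
    lra.
  have := fd z w sz (s_spec w ws) near => h.
  have : cabs (f z - f w) * k w z ^+ n <= e / 2 * k w z ^+ n by rewrite ler_wpM2r.
  have : 0 <= 2 * S * be ^+ n by rewrite !mulr_ge0// ltW.
  lra.
rewrite big_split /= -mulr_sumr -/(D z) big_const_seq count_predT iter_addr_0.
rewrite -mulr_natl -/m.
nra.
Qed.
End FunctionalCalculus.

(** * The real-valued norm and completeness *)

Section Norm.
Variables (R : realType) (A : cstarAlgType R).
Implicit Types (a b : A) (B : set A).

Lemma nrmE a : (nrm a)%:C%C = `|a|.
Proof. by rewrite RRe_real ?normr_real. Qed.

Lemma nrm_ge0 a : 0 <= nrm a.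
Proof. by rewrite -ler0c nrmE. Qed.

Lemma nrmD a b : nrm (a + b) <= nrm a + nrm b.
Proof. by rewrite -lecR rmorphD /= !nrmE ler_normD. Qed.

Lemma nrmZ (k : R[i]) a : nrm (k *: a) = cabs k * nrm a.
Proof. by apply: complexI; rewrite rmorphM /= cabsE !nrmE normrZ. Qed.

Lemma nrm0 : nrm (0 : A) = 0.
Proof. by rewrite /nrm normr0. Qed.

Lemma nrm_eq0 a : nrm a = 0 -> a = 0.
Proof. by move=> a0; apply/normr0_eq0; rewrite -nrmE a0. Qed.

Lemma nrmM a b : nrm (cmul a b) <= nrm a * nrm b.
Proof. by rewrite -lecR rmorphM /= !nrmE cnormM. Qed.

Lemma nrm_star_mul a : nrm (cmul (cstar a) a) = nrm a ^+ 2.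
Proof. by apply: complexI; rewrite rmorphXn /= !nrmE cnorm_star. Qed.

Lemma nrm_star a : nrm (cstar a) = nrm a.
Proof.
have le_star b : nrm b <= nrm (cstar b).
  have := nrmM (cstar b) b; rewrite nrm_star_mul.
  have := nrm_ge0 b; have := nrm_ge0 (cstar b); nra.
by apply/eqP; rewrite eq_le le_star andbT -{2}(cstarK a) le_star.
Qed.

Lemma cauchy_seq_cvg (K : numFieldType) (V : completeNormedModType K) (u : nat -> V) :
  (forall e : K, 0 < e -> exists n, forall m, (n <= m)%N -> `|u n - u m| < e) ->
  exists l : V, u @ \oo --> l.
Proof.
move=> u_cauchy; exists (lim (u @ \oo)).
suff : cvg (u @ \oo) by [].
apply: cauchy_cvg; apply/cauchyP => e e0.
have [n un] := u_cauchy e e0; exists (u n).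
exists n => // m /= nm; rewrite -ball_normE; exact: un.
Qed.

Lemma inv_succ_lt (e : R) : 0 < e ->
  exists n : nat, forall m, (n <= m)%N -> m.+1%:R^-1 < e.
Proof.
move=> e0; have [n] := ltr_add_invr e0; rewrite add0r => ne.
exists n => m nm; apply: le_lt_trans ne.
by rewrite lef_pV2 ?posrE// ler_nat.
Qed.

Lemma closed_complete B (u : nat -> A) : closed B -> (forall n, B (u n)) ->
  (forall e : R, 0 < e -> exists n, forall m, (n <= m)%N -> nrm (u n - u m) < e) ->
  exists2 l, B l & forall e : R, 0 < e ->
    exists n, forall m, (n <= m)%N -> nrm (u m - l) < e.
Proof.
move=> Bcl Bu u_cauchy.
have [e e0|l ul] := @cauchy_seq_cvg R[i] A u.
  have eR : e = (complex.Re e)%:C%C by rewrite RRe_real// gtr0_real.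
  have [|n un] := u_cauchy (complex.Re e); first by rewrite -ltcR -eR.
  by exists n => m nm; rewrite eR -nrmE ltcR un.
exists l; first by apply: (closed_cvg _ Bcl _ _ ul); exact: nearW.
move=> e e0; move/cvgrPdist_lt : ul => /(_ e%:C%C); rewrite ltcR => /(_ e0).
move=> [n _ nl]; exists n => m /nl /=.
by rewrite distrC -nrmE ltcR.
Qed.

Lemma complex_complete (u : nat -> R[i]) :
  (forall e : R, 0 < e -> exists n, forall m, (n <= m)%N -> cabs (u n - u m) < e) ->
  exists l, forall e : R, 0 < e ->
    exists n, forall m, (n <= m)%N -> cabs (u m - l) < e.
Proof.
move=> u_cauchy.
have Re_le (z : R[i]) : `|complex.Re z| <= cabs z.
  by rewrite -lecR cabsE; exact: normc_ge_Re.
have Im_le (z : R[i]) : `|complex.Im z| <= cabs z.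
  have := Re_le (z * 'i%C); rewrite ReiNIm normrN cabsM => /le_trans; apply.
  by rewrite (_ : cabs 'i%C = 1) ?mulr1// /cabs normc_def /= expr0n expr1n add0r sqrtr1.
have cvg_part (f : R[i] -> R) : (forall z w, f (z - w) = f z - f w) ->
    (forall z, `|f z| <= cabs z) -> exists l : R, forall e : R, 0 < e ->
    exists n, forall m, (n <= m)%N -> `|f (u m) - l| < e.
  move=> fB f_le; have [e e0|l ul] := @cauchy_seq_cvg R R^o (f \o u).
    have [n un] := u_cauchy e e0; exists n => m /un.
    by apply: le_lt_trans; rewrite /= -fB.
  exists l => e e0; move/cvgrPdist_lt : ul => /(_ e e0)[n _ nl].
  by exists n => m /nl /=; rewrite distrC.
have [||x ux] := cvg_part (@complex.Re R); [by case=> ? ? []|exact: Re_le|].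
have [||y uy] := cvg_part (@complex.Im R); [by case=> ? ? []|exact: Im_le|].
exists (x +i* y)%C => e e0; have e20 : 0 < e / 2 by rewrite divr_gt0.
have [n un] := ux _ e20; have [m um] := uy _ e20.
exists (maxn n m) => k; rewrite geq_max => /andP[/un nk /um mk].
rewrite [u k - _]complexE; apply: (le_lt_trans (cabsD _ _)).
rewrite cabsM !cabsR (_ : cabs 'i%C = 1) ?mul1r; last first.
  by rewrite /cabs normc_def /= expr0n expr1n add0r sqrtr1.
by move: nk mk; case: (u k) => a b /=; lra.
Qed.
End Norm.

(** * The unitization as a C*-algebra *)

Section Unitization.
Variables (R : realType) (A : cstarAlgType R).

Definition unitization : Type := (R[i] * A)%type.
HB.instance Definition _ := GRing.Zmodule.copy unitization (R[i] * A)%type.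

Implicit Types (x y z : unitization) (a b : A).

Let one : unitization := (1, 0).
Let mul x y : unitization := unitization_mul x y.
Let scale (k : R[i]) x : unitization := (k * x.1, k *: x.2).

Lemma cmul0 a : cmul a 0 = 0.
Proof. by apply: (@addrI _ (cmul a 0)); rewrite -cmulDr !addr0. Qed.

Lemma cmul0l a : cmul 0 a = 0.
Proof. by apply: (@addrI _ (cmul 0 a)); rewrite -cmulDl !addr0. Qed.

Fact unitization_mulA : associative mul.
Proof.
move=> [k a] [l b] [m c]; rewrite /mul /unitization_mul /=; congr pair.
  by rewrite mulrA.
rewrite !scalerDr !cmulDl !cmulDr !scalerA -!cscaleAl -!cscaleAr cmulA.
by rewrite !addrA [LHS](ACl (1*2*4*6*3*5*7))/= [k * m]mulrC [l * m]mulrC.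
Qed.

Fact unitization_mul1l : left_id one mul.
Proof.
by move=> [k a]; rewrite /mul /unitization_mul /= mul1r scale1r scaler0 cmul0l !addr0.
Qed.

Fact unitization_mul1r : right_id one mul.
Proof.
by move=> [k a]; rewrite /mul /unitization_mul /= mulr1 scale1r scaler0 cmul0 add0r addr0.
Qed.

Fact unitization_mulDl : left_distributive mul +%R.
Proof.
move=> [k a] [l b] [m c]; rewrite /mul /unitization_mul /=; congr pair.
  by rewrite mulrDl.
by rewrite /= scalerDl scalerDr cmulDl [RHS]addrACA; congr (_ + _); rewrite [RHS]addrACA.
Qed.

Fact unitization_mulDr : right_distributive mul +%R.
Proof.
move=> [k a] [l b] [m c]; rewrite /mul /unitization_mul /=; congr pair.
  by rewrite mulrDr.
by rewrite /= scalerDl scalerDr cmulDr [RHS]addrACA; congr (_ + _); rewrite [RHS]addrACA.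
Qed.

Fact unitization_one_neq0 : one != 0 :> unitization.
Proof. by apply/eqP => -[/eqP]; rewrite oner_eq0. Qed.

HB.instance Definition _ := GRing.Zmodule_isNzRing.Build unitization
  unitization_mulA unitization_mul1l unitization_mul1r
  unitization_mulDl unitization_mulDr unitization_one_neq0.

Fact unitization_scaleA (k l : R[i]) x : scale k (scale l x) = scale (k * l) x.
Proof. by rewrite /scale /= mulrA scalerA. Qed.

Fact unitization_scale1 : left_id 1 scale.
Proof. by case=> k a; rewrite /scale /= mul1r scale1r. Qed.

Fact unitization_scaleDr : right_distributive scale +%R.
Proof. by move=> k [l a] [m b]; rewrite /scale /= mulrDr scalerDr. Qed.

Fact unitization_scaleDl x : {morph scale^~ x : k l / k + l}.
Proof. by move=> k l; rewrite /scale /= mulrDl scalerDl. Qed.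

HB.instance Definition _ := GRing.Zmodule_isLmodule.Build R[i] unitization
  unitization_scaleA unitization_scale1 unitization_scaleDr unitization_scaleDl.

Fact unitization_scaleAl (k : R[i]) x y : k *: (x * y) = (k *: x) * y.
Proof.
case: x y => [l a] [m b]; congr pair; first by rewrite /= mulrA.
by rewrite /= !scalerDr !scalerA cscaleAl [m * k]mulrC.
Qed.

HB.instance Definition _ :=
  GRing.Lmodule_isLalgebra.Build R[i] unitization unitization_scaleAl.

Fact unitization_scaleAr (k : R[i]) x y : k *: (x * y) = x * (k *: y).
Proof.
case: x y => [l a] [m b]; congr pair; first by rewrite /= mulrCA.
by rewrite /= !scalerDr !scalerA cscaleAr [k * l]mulrC.
Qed.

HB.instance Definition _ :=
  GRing.Lalgebra_isAlgebra.Build R[i] unitization unitization_scaleAr.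

Definition unit_star x : unitization := (x.1^*, cstar x.2).

Lemma unit_star_is_star : is_star unit_star.
Proof.
split.
- by move=> [k a] [l b]; rewrite /unit_star /= rmorphD cstarD.
- by move=> k [l a]; rewrite /unit_star /= rmorphM cstarZ.
- move=> [k a] [l b]; congr pair; first by rewrite /= rmorphM mulrC.
  by rewrite /= !cstarD !cstarZ cstarM [X in X + _]addrC.
- by move=> [k a]; rewrite /unit_star /= conjCK cstarK.
Qed.

Definition unit_act x a : A := x.1 *: a + cmul x.2 a.

Lemma unit_actM x y a : unit_act (x * y) a = unit_act x (unit_act y a).
Proof.
case: x y => [k b] [l c]; rewrite /unit_act /= /unitization_mul /=.
rewrite !cmulDl !cmulDr !scalerDr !scalerA -!cscaleAl -!cscaleAr cmulA.
by rewrite !addrA.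
Qed.

Lemma unit_actD x y a : unit_act (x + y) a = unit_act x a + unit_act y a.
Proof. by rewrite /unit_act /= scalerDl cmulDl addrACA. Qed.

Lemma unit_actZ (k : R[i]) x a : unit_act (k *: x) a = k *: unit_act x a.
Proof. by rewrite /unit_act /= scalerDr scalerA cscaleAl. Qed.

Lemma unit_act1 a : unit_act 1 a = a.
Proof. by rewrite /unit_act /= scale1r cmul0l addr0. Qed.

Lemma unit_act_star x a b :
  cmul (cstar (unit_act x a)) b = cmul (cstar a) (unit_act (unit_star x) b).
Proof.
rewrite /unit_act cstarD cstarZ cstarM cmulDl cmulDr -cscaleAl cscaleAr.
by rewrite cmulA.
Qed.

Lemma unit_act_bound x a : nrm a <= 1 -> nrm (unit_act x a) <= cabs x.1 + nrm x.2.
Proof.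
move=> a1; apply: (le_trans (nrmD _ _)); rewrite nrmZ; apply: lerD.
  by rewrite -[leRHS]mulr1 ler_wpM2l// cabs_ge0.
by apply: (le_trans (nrmM _ _)); rewrite -[leRHS]mulr1 ler_wpM2l// nrm_ge0.
Qed.

Definition op_norm x : R := sup [set nrm (unit_act x a) | a in [set a | nrm a <= 1]].

Lemma op_norm_has_sup x : has_sup [set nrm (unit_act x a) | a in [set a | nrm a <= 1]].
Proof.
split; first by exists (nrm (unit_act x 0)), 0 => //=; rewrite nrm0.
by exists (cabs x.1 + nrm x.2) => _ [a a1 <-]; exact: unit_act_bound.
Qed.

Lemma op_norm_least x k : (forall a, nrm a <= 1 -> nrm (unit_act x a) <= k) ->
  op_norm x <= k.
Proof.
move=> xk; apply: ge_sup; first exact: (op_norm_has_sup x).1.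
by move=> _ [a a1 <-]; exact: xk.
Qed.

Lemma op_norm_le1 x a : nrm a <= 1 -> nrm (unit_act x a) <= op_norm x.
Proof.
by move=> a1; apply: sup_upper_bound; [exact: op_norm_has_sup|exists a].
Qed.

Lemma op_norm_ge0 x : 0 <= op_norm x.
Proof. by apply: le_trans (op_norm_le1 x (_ : nrm 0 <= 1)); rewrite ?nrm_ge0// nrm0. Qed.

Lemma unit_act_scale x (k : R[i]) a : unit_act x (k *: a) = k *: unit_act x a.
Proof. by rewrite /unit_act scalerDr cscaleAr !scalerA mulrC. Qed.

Lemma op_norm_le x a : nrm (unit_act x a) <= op_norm x * nrm a.
Proof.
have [/nrm_eq0 ->|a0] := eqVneq (nrm a) 0.
  by have := unit_act_scale x 0 0; rewrite !scale0r => ->; rewrite nrm0 mulr0.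
have a_gt0 : 0 < nrm a by rewrite lt_neqAle eq_sym a0 nrm_ge0.
rewrite -ler_pdivrMr// mulrC.
have cV : cabs ((nrm a)^-1)%:C%C = (nrm a)^-1 by rewrite cabsR gtr0_norm ?invr_gt0.
rewrite -cV -nrmZ -unit_act_scale; apply: op_norm_le1.
by rewrite nrmZ cV mulVf.
Qed.

(** The operator norm alone is degenerate when [A] has a unit [e]: it vanishes
    on [(1, - e)]. *)
Definition unit_norm x : R := Num.max (cabs x.1) (op_norm x).

Lemma unit_norm_ge x : cabs x.1 <= unit_norm x /\ op_norm x <= unit_norm x.
Proof. by rewrite /unit_norm !le_max !lexx orbT. Qed.

Lemma unit_norm_le x k : cabs x.1 <= k -> op_norm x <= k -> unit_norm x <= k.
Proof. by move=> *; rewrite /unit_norm ge_max; apply/andP. Qed.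

Lemma unit_norm_cstar : cstar_seminorm unit_star setT unit_norm.
Proof.
split.
- by move=> x _; apply: le_trans (unit_norm_ge x).1; exact: cabs_ge0.
- move=> x y _ _; have [x1 x2] := unit_norm_ge x; have [y1 y2] := unit_norm_ge y.
  apply: unit_norm_le.
    by apply: (le_trans (cabsD _ _)); exact: lerD.
  apply: op_norm_least => a a1; rewrite unit_actD; apply: (le_trans (nrmD _ _)).
  by apply: lerD; [apply: le_trans x2|apply: le_trans y2]; exact: op_norm_le1.
- have le_Z k x : unit_norm (k *: x) <= cabs k * unit_norm x.
    have [x1 x2] := unit_norm_ge x; apply: unit_norm_le.
      by rewrite cabsM ler_wpM2l// cabs_ge0.
    apply: op_norm_least => a a1; rewrite unit_actZ nrmZ ler_wpM2l ?cabs_ge0//.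
    by apply: le_trans x2; exact: op_norm_le1.
  move=> k x _; apply/eqP; rewrite eq_le le_Z/=.
  have [->|k0] := eqVneq k 0.
    rewrite cabs0 mul0r; apply: le_trans (unit_norm_ge _).1; exact: cabs_ge0.
  have := le_Z k^-1 (k *: x); rewrite scalerA mulVf// scale1r => le_x.
  have := ler_wpM2l (cabs_ge0 k) le_x.
  by rewrite mulrA -cabsM divff// cabs1 mul1r.
- move=> x y _ _; have [x1 x2] := unit_norm_ge x; have [y1 y2] := unit_norm_ge y.
  apply: unit_norm_le; first by rewrite cabsM ler_pM// cabs_ge0.
  apply: op_norm_least => a a1; rewrite unit_actM.
  apply: (le_trans (op_norm_le _ _)); apply: ler_pM => //.
  - exact: op_norm_ge0.
  - exact: nrm_ge0.
  - by apply: le_trans y2; exact: op_norm_le1.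
- apply/eqP; rewrite eq_le; apply/andP; split.
    apply: unit_norm_le; first by rewrite cabs1.
    by apply: op_norm_least => a; rewrite unit_act1.
  by apply: le_trans (unit_norm_ge _).1; rewrite cabs1.
- move=> x _; have [x1 x2] := unit_norm_ge (unit_star x * x).
  have n0 : 0 <= unit_norm (unit_star x * x).
    by apply: le_trans x1; exact: cabs_ge0.
  rewrite -[leRHS]sqr_sqrtr// ler_pXn2r ?nnegrE ?sqrtr_ge0//; last first.
    by apply: le_trans (unit_norm_ge x).1; exact: cabs_ge0.
  apply: unit_norm_le.
    rewrite -[leLHS]ger0_norm ?cabs_ge0// -sqrtr_sqr ler_sqrt//.
    by apply: le_trans x1; rewrite /= cabsM cabs_conj.
  apply: op_norm_least => a a1.
  rewrite -[leLHS]ger0_norm ?nrm_ge0// -sqrtr_sqr ler_sqrt//.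
  rewrite -nrm_star_mul unit_act_star -unit_actM.
  apply: (le_trans (nrmM _ _)); rewrite nrm_star -[leRHS]mul1r.
  apply: ler_pM => //; rewrite ?nrm_ge0//.
  by apply: le_trans x2; exact: op_norm_le1.
Qed.

Definition embed a : unitization := (0, a).

Lemma unit_norm_embed a : unit_norm (embed a) = nrm a.
Proof.
have actE b : unit_act (embed a) b = cmul a b.
  by rewrite /unit_act /= scale0r add0r.
apply/eqP; rewrite eq_le; apply/andP; split.
  apply: unit_norm_le; first by rewrite cabs0 nrm_ge0.
  apply: op_norm_least => b b1; rewrite actE; apply: (le_trans (nrmM _ _)).
  by rewrite -[leRHS]mulr1 ler_wpM2l// nrm_ge0.
apply: le_trans (unit_norm_ge _).2.
have := op_norm_le (embed a) (cstar a); rewrite actE -{1}(cstarK a) nrm_star_mul nrm_star.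
have := op_norm_ge0 (embed a); have := nrm_ge0 a.
by nra.
Qed.

Lemma unit_norm_snd x : nrm x.2 <= 2 * unit_norm x.
Proof.
rewrite -unit_norm_embed (_ : embed x.2 = x - x.1%:A); last first.
  by case: x => k a; rewrite /embed; congr pair; rewrite /= ?mulr1 ?subrr// scaler0 subr0.
apply: (le_trans (snB (star_subalgebraT unit_star) unit_norm_cstar _ _)) => //.
rewrite (snA (star_subalgebraT _) unit_norm_cstar).
by have := (unit_norm_ge x).1; lra.
Qed.

Lemma unit_norm_le_sum x : unit_norm x <= cabs x.1 + nrm x.2.
Proof.
apply: unit_norm_le; first by rewrite lerDl nrm_ge0.
by apply: op_norm_least; exact: unit_act_bound.
Qed.

Lemma unit_norm_eq0 x : unit_norm x = 0 -> x = 0.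
Proof.
move=> x0; have := unit_norm_snd x; have := (unit_norm_ge x).1; rewrite x0 mulr0.
case: x {x0} => k a /= k0 a0; congr pair.
  by apply: cabs_eq0; apply/eqP; rewrite eq_le k0 cabs_ge0.
by apply: nrm_eq0; apply/eqP; rewrite eq_le a0 nrm_ge0.
Qed.

Section Subalgebra.
Variable B : set A.
Hypotheses (B_sub : is_cstar_subalgebra B) (B_central : central B).

Definition unit_sub : set unitization := [set x | B x.2].

Lemma unit_sub_star_subalgebra : star_subalgebra unit_star unit_sub.
Proof.
have [B0 [BD [BZ [BM [Bs _]]]]] := B_sub.
split; rewrite /unit_sub /=.
- exact: B0.
- by move=> x y; exact: BD.
- by move=> k x; exact: BZ.
- by move=> x y Bx By; apply: (BD); [apply: (BD); exact: BZ|exact: BM].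
- by move=> x; exact: Bs.
Qed.

Lemma unit_sub_central x y : unit_sub x -> x * y = y * x.
Proof.
case: x y => [k a] [l b] Ba; congr pair; first by rewrite /= mulrC.
by rewrite /= B_central// [X in X + _]addrC.
Qed.

Lemma unit_sub_commutative : commutative_set unit_sub.
Proof. by move=> x y Bx _; exact: unit_sub_central. Qed.

Lemma unit_sub_complete (u : nat -> unitization) : (forall n, unit_sub (u n)) ->
  (forall n m, unit_norm (u n - u m) <= n.+1%:R^-1 + m.+1%:R^-1) ->
  exists2 l, unit_sub l & forall n, unit_norm (u n - l) <= n.+1%:R^-1.
Proof.
move=> Bu u_cauchy; have [_ [_ [_ [_ [_ B_closed]]]]] := B_sub.
have small (e : R) : 0 < e -> exists n, forall m, (n <= m)%N ->
    unit_norm (u n - u m) < e.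
  move=> e0; have [|n ne] := @inv_succ_lt R (e / 2); first by rewrite divr_gt0.
  exists n => m nm; apply: le_lt_trans (u_cauchy n m) _.
  by rewrite [ltRHS]splitr ltrD// ne.
have [|c uc] := @complex_complete R (fun n => (u n).1).
  move=> e /small[n un]; exists n => m /un; apply: le_lt_trans.
  exact: (unit_norm_ge (u n - u m)).1.
have [|b Bb ub] := @closed_complete R A B (fun n => (u n).2) B_closed Bu.
  move=> e e0; have [|n un] := small (e / 2); first by rewrite divr_gt0.
  exists n => m /un; have := unit_norm_snd (u n - u m) => /=; lra.
exists (c, b) => // n; apply/ler_addgt0Pl => e e0.
have e30 : 0 < e / 3 by rewrite divr_gt0.
have [n1 h1] := uc _ e30; have [n2 h2] := ub _ e30; have [n3 h3] := inv_succ_lt e30.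
pose m := maxn n1 (maxn n2 n3).
have {}h1 := h1 m (leq_maxl _ _).
have {}h2 : nrm ((u m).2 - b) < e / 3.
  by apply: h2; rewrite leq_max [X in _ || X]leq_max leqnn orbT.
have {}h3 : m.+1%:R^-1 < e / 3 :> R.
  by apply: h3; rewrite leq_max [X in _ || X]leq_max leqnn !orbT.
have h4 : unit_norm (u m - (c, b)) <= cabs ((u m).1 - c) + nrm ((u m).2 - b).
  exact: unit_norm_le_sum.
have h5 : unit_norm (u n - (c, b)) <= unit_norm (u n - u m) + unit_norm (u m - (c, b)).
  rewrite -[in leLHS](subrK (u m) (u n)) -addrA.
  exact: (snD unit_norm_cstar).
have h6 := u_cauchy n m.
move: h1 h2 h3 h4 h5 h6; set k := m.+1%:R^-1; set k' := n.+1%:R^-1.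
lra.
Qed.

End Subalgebra.
End Unitization.

(** * The norm estimates *)

Section Retraction.
Variables (R : realType) (U : algType R[i]) (star : U -> U) (N : U -> R).
Hypotheses (Hs : is_star star) (HN : cstar_seminorm star setT N).
Implicit Types (a g l : U) (r : R).

Lemma retraction_identity (V : zmodType) (a p q x b s : V) :
  a - p - (q - x) = a + (b + x + (s - (b + p + (q + s)))).
Proof.
rewrite (_ : s - _ = - (b + (p + q))); last first.
  by rewrite !addrA opprD addrCA subrr addr0.
by rewrite [- (b + _)]opprD addrACA subrr add0r !opprD opprK !addrA [RHS](ACl (1*3*4*2)).
Qed.

(** With [k = l * l], [d = a - g] and [D = d - k g], centrality and
    [k g^* g = r^2 k] give [D^* D = d^* d + k d^* d + k^2 g^* g + k (r^2 - a^* a)],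
    and every term is positive. *)
Lemma norm_sub_retraction_le a g l r : (forall x, g * x = x * g) ->
  (forall x, l * x = x * l) -> star l = l ->
  l * l * (star g * g) = (r ^+ 2)%:C%C *: (l * l) -> 0 <= r -> N a <= r ->
  N (a - g) <= N (a - (g + l * l * g)).
Proof.
move=> gC lC ll kg r0 ar.
have HT := star_subalgebraT star.
have NsT x : N (star x * x) = N x ^+ 2 by exact: (sn_star Hs HT HN).
have N0 x : 0 <= N x by exact: (sn_ge0 HN).
have [d dE] : exists d, d = a - g by exists (a - g).
rewrite -dE; have [k kE] : exists k, k = l * l by exists (l * l).
rewrite -kE in kg *.
have kC x : k * x = x * k by rewrite kE -mulrA lC -mulrA lC mulrA.
have kk : star k = k by rewrite kE (starM Hs) ll.
have DE : a - (g + k * g) = d - k * g by rewrite opprD addrA dE.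
rewrite DE -(@ler_pXn2r _ 2) ?nnegrE// -!NsT.
pose e := (r ^+ 2)%:C%C%:A - star a * a.
have pe : pos star N e.
  apply: (pos_norm_sub Hs); first by rewrite (starM Hs) (starK Hs).
  by rewrite NsT ler_pXn2r ?nnegrE.
have -> : star (d - k * g) * (d - k * g) =
    star d * d + (star (l * d) * (l * d) + star (k * g) * (k * g) + l * e * l).
  have -> : star (l * d) * (l * d) = k * (star d * d).
    by rewrite (starM Hs) ll -mulrA (mulrA l) -kE mulrA -kC -mulrA.
  have -> : l * e * l = k * (star g * g) - k * (star a * a).
    by rewrite -mulrA -lC mulrA -kE /e mulrBr kg -scalerAr mulr1.
  have aE : a = d + g by rewrite dE subrK.
  rewrite [in RHS]aE (starD Hs d g) [in RHS]mulrDl ![in RHS]mulrDr.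
  rewrite (starB Hs) mulrBl !mulrBr (starM Hs) kk.
  rewrite (mulrA (star d) k) -(kC (star d)) -(mulrA k) -(mulrA (star g) k d) (kC d).
  rewrite (mulrA (star g) d) -(kC (star g * d)).
  move: (star d * d) (k * _) (k * _) (k * _) (k * _) (star g * k * (k * g)).
  move=> a1 p q ka s X; exact: retraction_identity.
apply: (norm_le_add_pos Hs HN); first exact: (pos_star_mul Hs HN).
apply: (posD Hs HN); first by apply: (posD Hs HN); exact: (pos_star_mul Hs HN).
by apply: (pos_conj Hs HN).
Qed.

(** Monotonicity of the norm, applied to the positive elements [star g * g] and
    [q * q] of sum [r^2]. *)
Lemma norm_le_of_sqr_complement g q r : 0 <= r -> star q = q ->
  star g * g + q * q = (r ^+ 2)%:C%C%:A -> N g <= r.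
Proof.
move=> r0 qq gq; have N0 x : 0 <= N x by exact: (sn_ge0 HN).
rewrite -(@ler_pXn2r _ 2) ?nnegrE//.
rewrite -(sn_star Hs (star_subalgebraT star) HN)//.
have := norm_le_add_pos Hs HN (pos_star_mul Hs HN g) (pos_sqr Hs HN qq).
by rewrite gq (snA (star_subalgebraT star) HN) cabsR ger0_norm// sqr_ge0.
Qed.
End Retraction.

(** * Existence of the functional calculus *)

Section Existence.
Variables (R : realType) (A : cstarAlgType R) (B : set A).
Hypotheses (B_sub : is_cstar_subalgebra B) (B_central : central B).
Variable F : A.
Hypothesis BF : B F.

Local Notation U := (unitization A).
Local Notation C := (@unit_sub R A B).
Local Notation value := (calculus_value (@unit_star R A) (@unit_norm R A) C (embed F)).

Let Hs := unit_star_is_star A.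
Let HC := unit_sub_star_subalgebra B_sub.
Let CC := unit_sub_commutative B_central.
Let HN := cstar_seminorm_sub (unit_norm_cstar A) C.
Let N_eq0 x (_ : C x) := @unit_norm_eq0 R A x.
Let C_complete := unit_sub_complete B_sub.
Let CF : C (embed F) := BF.

Lemma unital_spectrum_unit_sub : unital_spectrum C (embed F) = spectrum B F.
Proof.
have E l : l%:A - embed F = (l, - F) :> U.
  by congr pair; rewrite /= ?mulr1 ?subr0// scaler0 sub0r.
apply/seteqP; split => l lF [y].
- by move=> [By y1 y2]; apply: lF; exists y; rewrite E.
- by rewrite E => -[By y1 y2]; apply: lF; exists y.
Qed.

Lemma continuous_in_calculus_spectrum f :
  {within (spectrum B F : set R[i]^o), continuous (f : R[i]^o -> R[i]^o)} ->
  exists x, value f x.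
Proof.
rewrite -unital_spectrum_unit_sub.
exact: (continuous_in_calculus Hs HC CC HN N_eq0 C_complete CF).
Qed.

(** The character that vanishes on [A]. *)
Lemma scalar_part_character : character (@unit_star R A) C (@unit_norm R A) (fun x => x.1).
Proof. by split=> //= x _; exact: (unit_norm_ge x).1. Qed.

Definition calculus (f : R[i] -> R[i]) : A := (xget (0 : U) [set x | value f x]).2.

(** At [scalar_part_character], [F] takes the value [0]. *)
Lemma calculusP f : f 0 = 0 -> (exists x, value f x) -> value f (embed (calculus f)).
Proof.
move=> f0 fE; have /= vf := xgetPex (0 : U) fE.
suff -> : embed (calculus f) = xget (0 : U) [set x | value f x] by [].
rewrite /calculus; case: (xget _ _) vf => c b [_ /(_ _ scalar_part_character) /= ->].
by rewrite f0.
Qed.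

Lemma calculus_unique f g (a b : A) : value f (embed a) -> value g (embed b) ->
  (forall z, spectrum B F z -> f z = g z) -> a = b.
Proof.
move=> fa gb fg.
suff /(congr1 snd) : embed a = embed b by [].
apply: (calculus_value_inj Hs HC CC HN N_eq0 fa gb) => z.
by move=> /(character_values_spec HC CF); rewrite unital_spectrum_unit_sub; exact: fg.
Qed.

Lemma is_cfc_calculus : is_cfc B F calculus.
Proof.
have val f : cfc_dom B F f -> value f (embed (calculus f)).
  by move=> [/continuous_in_calculus_spectrum fE f0]; exact: calculusP.
have same f a : f 0 = 0 -> value f (embed a) -> calculus f = a.
  move=> f0 fa; apply: calculus_unique (fa) _ => //.
  by apply: calculusP => //; exists (embed a).
split.
- by move=> f /val[].
- by move=> f g /val fv /val gv; exact: calculus_unique fv gv.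
- move=> f g df dg; apply: same; first by rewrite df.2 dg.2 addr0.
  have := calculus_valueD HC (val f df) (val g dg).
  by congr (value _ _); congr pair; rewrite addr0.
- move=> k f df; apply: same; first by rewrite df.2 mulr0.
  have := calculus_valueZ HC k (val f df).
  by congr (value _ _); congr pair; rewrite mulr0.
- move=> f g df dg; apply: same; first by rewrite df.2 dg.2 mulr0.
  have := calculus_valueM HC (val f df) (val g dg).
  by congr (value _ _); congr pair; rewrite /= ?mulr0// !scale0r !add0r.
- move=> f df; apply: same; first by rewrite df.2 conjC0.
  have := calculus_value_star HC (val f df).
  by congr (value _ _); congr pair; rewrite conjC0.
- by apply: same => //; split.
Qed.
End Existence.

(** * The radial retraction *)

Section Radial.
Variable R : realType.
Implicit Types (r : R) (z : R[i]).

Lemma continuous_real_of_cabs (u : R -> R) : continuous (u : R^o -> R^o) ->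
  continuous (fun z : R[i]^o => (u (cabs z))%:C%C : R[i]^o).
Proof.
move=> uc z.
apply: (@continuous_comp R[i]^o R^o R[i]^o (fun w => u (cabs w)) (fun t => t%:C%C)).
  by apply: (@continuous_comp R[i]^o R^o R^o (@cabs R) u); [exact: cabs_continuous|exact: uc].
exact: real_complex_continuous.
Qed.

Lemma conj_continuous : continuous (fun z : R[i]^o => z^* : R[i]^o).
Proof.
move=> z X /nbhs_complexP[e e0 zX]; apply/nbhs_complexP; exists e => // w wz.
by apply: zX; rewrite -rmorphB cabs_conj.
Qed.

(** On the real line, [shrink r], [excess r] and [defect r] are the functions of
    [t = |z|] through which the retraction acts: [radial r z = shrink r t z],
    [z = (1 + excess r t ^ 2) radial r z] and
    [|radial r z|^2 = r^2 - defect r t ^ 2]. *)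
Definition shrink r (t : R) := r / Num.max r t.
Definition excess r (t : R) := Num.sqrt (Num.max r t / r - 1).
Definition defect r (t : R) := Num.sqrt (r ^+ 2 - (shrink r t * t) ^+ 2).

Lemma radialE r z : 0 < r -> radial r z = z * (shrink r (cabs z))%:C%C.
Proof.
move=> r0; rewrite /radial /shrink ler_norm_cabs.
have [zr|rz] := lerP (cabs z) r; first by rewrite divff ?gt_eqF// rmorph1 mulr1.
by rewrite rmorphM /= fmorphV /= cabsE mulrA [_%:C%C * z]mulrC.
Qed.

Lemma max_gt0 r (t : R) : 0 < r -> 0 < Num.max r t.
Proof. by move=> r0; rewrite lt_max r0. Qed.

Lemma excess_sqr r (t : R) : 0 < r -> excess r t ^+ 2 = Num.max r t / r - 1.
Proof.
by move=> r0; rewrite sqr_sqrtr// subr_ge0 ler_pdivlMr// mul1r le_max lexx.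
Qed.

Lemma shrink_le r (t : R) : 0 < r -> 0 <= t -> 0 <= shrink r t * t <= r.
Proof.
move=> r0 t0; have m0 := max_gt0 t r0.
rewrite /shrink mulr_ge0 ?divr_ge0 ?(ltW r0) ?(ltW m0)//=.
by rewrite mulrAC ler_pdivrMr// ler_wpM2l ?(ltW r0)// le_max lexx orbT.
Qed.

Lemma defect_sqr r (t : R) : 0 < r -> 0 <= t ->
  defect r t ^+ 2 = r ^+ 2 - (shrink r t * t) ^+ 2.
Proof.
move=> r0 t0; have /andP[s0 sr] := shrink_le r0 t0.
by rewrite sqr_sqrtr// subr_ge0 ler_pXn2r ?nnegrE// ltW.
Qed.

Lemma cabs_radial r z : 0 < r -> cabs (radial r z) = shrink r (cabs z) * cabs z.
Proof.
move=> r0; have m0 := max_gt0 (cabs z) r0.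
by rewrite radialE// cabsM cabsR ger0_norm ?divr_ge0 ?(ltW r0) ?(ltW m0)// mulrC.
Qed.

Lemma radial_excess r z : 0 < r ->
  radial r z + ((excess r (cabs z) ^+ 2)%:C)%C * radial r z = z.
Proof.
move=> r0; have m0 := max_gt0 (cabs z) r0.
rewrite excess_sqr// rmorphB rmorph1 mulrBl mul1r addrC subrK radialE//.
rewrite mulrCA -rmorphM /= /shrink mulrA divfK ?gt_eqF// divff ?gt_eqF// rmorph1 mulr1.
by [].
Qed.

Lemma excess_cabs_radial r z : 0 < r ->
  excess r (cabs z) ^+ 2 * cabs (radial r z) ^+ 2 = r ^+ 2 * excess r (cabs z) ^+ 2.
Proof.
move=> r0; rewrite excess_sqr// cabs_radial// /shrink.
have [zr|rz] := lerP (cabs z) r; first by rewrite divff ?gt_eqF// subrr mul0r mulr0.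
by rewrite divfK ?gt_eqF ?(lt_trans r0)// mulrC.
Qed.

Let max_continuous r : continuous (fun t : R^o => Num.max r t : R^o).
Proof. by move=> t; apply: continuous_max; [exact: cvg_cst|exact: cvg_id]. Qed.

Lemma shrink_continuous r : 0 < r -> continuous (shrink r : R^o -> R^o).
Proof.
move=> r0 t; apply: cvgM; first exact: cvg_cst.
by apply: cvgV; [rewrite gt_eqF// max_gt0|exact: max_continuous].
Qed.

Lemma excess_continuous r : continuous (excess r : R^o -> R^o).
Proof.
move=> t; apply: continuous_comp; last exact: sqrt_continuous.
apply: cvgB; last exact: cvg_cst.
by apply: cvgM; [exact: max_continuous|exact: cvg_cst].
Qed.

Lemma defect_continuous r : 0 < r -> continuous (defect r : R^o -> R^o).
Proof.
move=> r0 t; apply: continuous_comp; last exact: sqrt_continuous.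
apply: cvgB; first exact: cvg_cst.
apply: cvgM; apply: cvgM; by [exact: shrink_continuous|exact: cvg_id].
Qed.

Lemma radial_continuous r : 0 < r -> continuous (radial r : R[i]^o -> R[i]^o).
Proof.
move=> r0; rewrite (_ : radial r = fun z => z * (shrink r (cabs z))%:C%C); last first.
  by apply/funext => z; exact: radialE.
have id_cont : continuous (id : R[i]^o -> R[i]^o) by move=> z; exact: cvg_id.
have sh_cont := continuous_real_of_cabs (shrink_continuous r0).
by move=> z; exact: (@continuousM R[i] R[i]^o _ _ z (id_cont z) (sh_cont z)).
Qed.
End Radial.

Section Main.
Variables (R : realType) (A : cstarAlgType R) (B : set A).
Hypotheses (B_sub : is_cstar_subalgebra B) (B_central : central B).

Lemma cfc_dom_continuous F (f : R[i] -> R[i]) :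
  continuous (f : R[i]^o -> R[i]^o) -> f 0 = 0 -> cfc_dom B F f.
Proof. by move=> fc f0; split=> //; exact: continuous_subspaceT. Qed.

Lemma radial_retraction_cfc r F : B F ->
  exists2 Phi, is_cfc B F Phi & radial_retraction B r F = Phi (radial r).
Proof.
move=> BF; rewrite /radial_retraction /cfc.
have [|Phi HPhi PhiE] := @xgetPex _ (0 : A)
    [set G | exists2 Phi, is_cfc B F Phi & Phi (radial r) = G].
  exists (calculus B F (radial r)).
  by exists (calculus B F) => //; exact: is_cfc_calculus.
by exists Phi.
Qed.

Section OneElement.
Variables (F : A) (Phi : (R[i] -> R[i]) -> A).
Hypotheses (BF : B F) (HPhi : is_cfc B F Phi).

Lemma radial0 (z : R[i]) : radial 0 z = 0.
Proof.
rewrite /radial ler_norm_cabs; case: ifP => [z0|_]; last by rewrite rmorph0 !mul0r.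
by apply: cabs_eq0; apply/eqP; rewrite eq_le z0 cabs_ge0.
Qed.

Lemma cfc_radial0 : Phi (radial 0) = 0.
Proof.
have did : cfc_dom B F id by apply: cfc_dom_continuous => // z; exact: cvg_id.
rewrite (_ : radial 0 = fun z => 0 * z); last first.
  by apply/funext => z; rewrite radial0 mul0r.
by rewrite (cfcZ HPhi)// scale0r.
Qed.

Variable r : R.
Hypothesis r0 : 0 < r.
Let G := Phi (radial r).

Let dom_real (u : R -> R) : continuous (u : R^o -> R^o) -> u 0 = 0 ->
  cfc_dom B F (fun z => (u (cabs z))%:C%C).
Proof.
move=> uc u0; apply: cfc_dom_continuous; last by rewrite cabs0 u0.
exact: continuous_real_of_cabs.
Qed.

Let dom_mul f g : cfc_dom B F f -> cfc_dom B F g -> cfc_dom B F (fun z => f z * g z).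
Proof.
move=> [fc f0] [gc g0]; split; last by rewrite f0 mul0r.
by move=> z; apply: cvgM; [exact: fc|exact: gc].
Qed.

Let radial_at0 : radial r 0 = 0.
Proof. by rewrite radialE// mul0r. Qed.

Lemma cfc_dom_radial : cfc_dom B F (radial r).
Proof. by apply: cfc_dom_continuous; [exact: radial_continuous|]. Qed.

Let dom_conj : cfc_dom B F (fun z => (radial r z)^*).
Proof.
apply: cfc_dom_continuous; last by rewrite radial_at0 conjC0.
move=> z; apply: (@continuous_comp R[i]^o R[i]^o R[i]^o (radial r) (fun w => w^*)).
  exact: radial_continuous.
exact: conj_continuous.
Qed.

Let excess0 : excess r 0 = 0.
Proof. by rewrite /excess max_l ?(ltW r0)// divff ?gt_eqF// subrr sqrtr0. Qed.

Let defect0 : r - defect r 0 = 0.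
Proof.
by rewrite /defect mulr0 expr0n subr0 sqrtr_sqr gtr0_norm// subrr.
Qed.

Let L := Phi (fun z => (excess r (cabs z))%:C%C).
Let Q := Phi (fun z => (r - defect r (cabs z))%:C%C).

Let dL : cfc_dom B F (fun z => (excess r (cabs z))%:C%C).
Proof. by apply: dom_real => //; exact: excess_continuous. Qed.

Let dQ : cfc_dom B F (fun z => (r - defect r (cabs z))%:C%C).
Proof.
apply: (@dom_real (fun t => r - defect r t)) => //.
by move=> t; apply: cvgB; [exact: cvg_cst|exact: defect_continuous].
Qed.

Let cstar_real (u : R -> R) : cfc_dom B F (fun z => (u (cabs z))%:C%C) ->
  cstar (Phi (fun z => (u (cabs z))%:C%C)) = Phi (fun z => (u (cabs z))%:C%C).
Proof.
move=> du; rewrite -(cfc_star HPhi)//; congr Phi; apply/funext => z.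
exact: conj_real_complex.
Qed.

Let cL : cstar L = L.
Proof. exact: cstar_real. Qed.

Let cQ : cstar Q = Q.
Proof. exact: (@cstar_real (fun t => r - defect r t)). Qed.

Let GG : cmul (cstar G) G = Phi (fun z => ((cabs (radial r z) ^+ 2)%:C)%C).
Proof.
rewrite -(cfc_star HPhi) -?(cfcM HPhi)//; try exact: cfc_dom_radial.
by congr Phi; apply/funext => z; rewrite mulrC -cabs_sqr.
Qed.

Let dGG : cfc_dom B F (fun z => ((cabs (radial r z) ^+ 2)%:C)%C).
Proof.
rewrite (_ : (fun _ => _) = fun z => radial r z * (radial r z)^*); last first.
  by apply/funext => z; rewrite -cabs_sqr.
exact: dom_mul cfc_dom_radial dom_conj.
Qed.

Lemma radial_decomposition : F = G + cmul (cmul L L) G.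
Proof.
rewrite -(cfc_id HPhi) -!(cfcM HPhi)//; try exact: cfc_dom_radial; last exact: dom_mul.
rewrite -(cfcD HPhi); [|exact: cfc_dom_radial|].
  congr Phi; apply/funext => z; rewrite -rmorphM /= -expr2 radial_excess//.
by apply: dom_mul cfc_dom_radial; exact: dom_mul.
Qed.

Lemma radial_support : cmul (cmul L L) (cmul (cstar G) G) = (r ^+ 2)%:C%C *: cmul L L.
Proof.
rewrite GG -!(cfcM HPhi)//; last exact: dom_mul.
rewrite -(cfcZ HPhi); last exact: dom_mul.
by congr Phi; apply/funext => z; rewrite -!rmorphM /= -!expr2 excess_cabs_radial.
Qed.

(** [Q] stands for [r - sqrt (r^2 - |radial r z|^2)], which vanishes at [0]
    whereas the square root does not. *)
Lemma radial_complement : cmul (cstar G) G = (2 * r)%:C%C *: Q - cmul Q Q.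
Proof.
rewrite GG -(cfcM HPhi)// -(cfcZ HPhi)//; apply: (@addIr _ (cmul Q Q)).
have dQ2 := dom_mul dQ dQ.
rewrite -(cfcM HPhi)// subrK -(cfcD HPhi)//; congr Phi; apply/funext => z.
rewrite -!rmorphM -rmorphD /=; congr (_%:C)%C.
have := defect_sqr r0 (cabs_ge0 z); rewrite -cabs_radial//.
by move: (defect _ _) (cabs (radial _ _)) => s t; lra.
Qed.

Lemma cfc_radial_mem : B G.
Proof. by apply: (cfc_mem HPhi); exact: cfc_dom_radial. Qed.

Let Hs := unit_star_is_star A.
Let HN := unit_norm_cstar A.

Let embedD (a b : A) : embed (a + b) = embed a + embed b.
Proof. by congr pair; rewrite addr0. Qed.

Let embedB (a b : A) : embed (a - b) = embed a - embed b.
Proof. by congr pair; rewrite subr0. Qed.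

Let embedM (a b : A) : embed (cmul a b) = embed a * embed b.
Proof. by congr pair; rewrite /= ?mulr0// !scale0r !add0r. Qed.

Let embedZ (k : R[i]) (a : A) : embed (k *: a) = k *: embed a.
Proof. by congr pair; rewrite /= mulr0. Qed.

Let embed_star (a : A) : embed (cstar a) = unit_star (embed a).
Proof. by congr pair; rewrite /= conjC0. Qed.

Lemma cfc_radial_norm : nrm G <= r.
Proof.
rewrite -unit_norm_embed.
apply: (norm_le_of_sqr_complement Hs HN (q := r%:C%C%:A - embed Q)); first exact: ltW.
  by rewrite (starB Hs) (star_real Hs) -embed_star cQ.
rewrite -embed_star -embedM radial_complement embedB embedZ embedM.
rewrite mulrBl !mulrBr !mulr_algl mulr_algr mulr_natl mulr2n.
rewrite rmorphD scalerDl scalerA -rmorphM -[r * r]expr2 /=.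
have e (t p s : unitization A) : p + p - s + (t - p - (p - s)) = t.
  by rewrite -(addrA t) -opprD (addrA p) [LHS]addrC subrK.
exact: e.
Qed.

Lemma cfc_radial_dist a : nrm a <= r -> nrm (a - G) <= nrm (a - F).
Proof.
move=> ar; rewrite [in leRHS]radial_decomposition -!unit_norm_embed.
rewrite !embedB embedD !embedM.
apply: (norm_sub_retraction_le Hs HN (r := r)).
- by move=> x; apply: unit_sub_central B_central _ _ _; exact: cfc_radial_mem.
- by move=> x; apply: unit_sub_central B_central _ _ _; exact: (cfc_mem HPhi).
- by rewrite -embed_star cL.
- by rewrite -embed_star -!embedM radial_support embedZ.
- exact: ltW.
- by rewrite unit_norm_embed.
Qed.
End OneElement.

Lemma radial_retraction_bounds a F : B F ->
  let G := radial_retraction B (nrm a) F in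
  [/\ B G, nrm (a - G) <= nrm (a - F) & nrm G <= nrm a].
Proof.
move=> BF G; have [Phi HPhi] := radial_retraction_cfc (nrm a) BF.
rewrite -/G => ->; have [a0|a0] := eqVneq (nrm a) 0.
  rewrite a0 (cfc_radial0 HPhi) nrm0 (nrm_eq0 a0) subr0 nrm0 nrm_ge0.
  by rewrite lexx; split=> //; exact: B_sub.1.
have a_gt0 : 0 < nrm a by rewrite lt_neqAle eq_sym a0 nrm_ge0.
split; [exact: (cfc_radial_mem HPhi)| |exact: (cfc_radial_norm HPhi)].
exact: (cfc_radial_dist HPhi).
Qed.
End Main.

Theorem proposition2p3 (R : realType) (A : cstarAlgType R) (B : set A)
    (B_sub : is_cstar_subalgebra B) (B_central : central B) :
  same_norm_approximation_property B /\
  (forall a F : A, B F ->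
     let G := radial_retraction B (nrm a) F in
     nrm (a - G) <= nrm (a - F) /\ nrm G <= nrm a).
Proof.
split; last first.
  by move=> a F BF G; have [] := radial_retraction_bounds B_sub B_central a BF.
move=> a e e0.
have B0 : B 0 by have [] := B_sub.
have [|_ [F BF <-] aF] := @inf_adherent _ [set nrm (a - b) | b in B] e e0.
  split; first by exists (nrm (a - 0)), 0.
  by exists 0 => _ [b _ <-]; exact: nrm_ge0.
have [BG aG Ga] := radial_retraction_bounds B_sub B_central a BF.
exists (radial_retraction B (nrm a) F); split=> //; split=> //.
exact: le_lt_trans aG aF.
Qed.
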